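(* Let $(W,S)$ be a Coxeter system of universal type (i.e. $m_{st}=\infty$ for all $s\neq t\in S$) of finite rank at least $2$, and let $s_0,s_1\in S$ be distinct. Then $\mathcal{M}(s_0,s_1)$ is a Weyl-invariant commutator blueprint of type $(W,S)$. Moreover, the groups $U_w$ ($w\in W$) are nilpotent of class at most $2$.
   Context: Galleries and roots. Let $(W,S)$ be a Coxeter system of finite rank with length function $\ell$; $m_{st}$ is the order of $st$. Elements of $W$ are called chambers. A gallery is a sequence $(w_0,\ldots,w_n)$ of chambers with $s_i:=w_{i-1}^{-1}w_i\in S$; $(s_1,\ldots,s_n)$ is its type; it is minimal if $\ell(w_0^{-1}w_n)=n$. For $s\in S$ put $\alpha_s=\{w\in W\mid \ell(sw)>\ell(w)\}$. A root is a set $v\alpha_s$ with $v\in W,s\in S$; $\Phi$ is the set of roots, $\Phi_+$ the set of roots containing $1_W$, $-\alpha=W\setminus\alpha$. A pair $\{\alpha,\beta\}$ of roots is prenilpotent if $\alpha\cap\beta\neq\emptyset\neq(-\alpha)\cap(-\beta)$; then $[\alpha,\beta]=\{\gamma\in\Phi\mid\alpha\cap\beta\subseteq\gamma,\ (-\alpha)\cap(-\beta)\subseteq-\gamma\}$ and $(\alpha,\beta)=[\alpha,\beta]\setminus\{\alpha,\beta\}$. A minimal gallery $(c_0,\ldots,c_k)$ crosses the sequence of roots $(\alpha_1,\ldots,\alpha_k)$, where $\alpha_i$ is the unique root with $c_{i-1}\in\alpha_i$, $c_i\notin\alpha_i$; it is then called a minimal gallery between $\alpha_1$ and $\alpha_k$.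 $\mathrm{Min}$ is the set of minimal galleries starting at $1_W$, and $\mathrm{Min}(w)$ the set of those ending at $w$. For $w\in W$ with $\ell(sw)=\ell(w)-1$, $\mathrm{Min}_s(w)$ is the set of $G\in\mathrm{Min}(w)$ whose type begins with $s$; if $\ell(sw)=\ell(w)+1$, $\mathrm{Min}_s(w)=\mathrm{Min}(w)$. For $G=(c_0,\ldots,c_k)\in\mathrm{Min}_s(w)$ put $sG=(sc_1,\ldots,sc_k)$ if $\ell(sw)=\ell(w)-1$ and $sG=(1_W,sc_0,\ldots,sc_k)$ if $\ell(sw)=\ell(w)+1$. For $w\in W$ let $\Phi(w)=\{\alpha\in\Phi_+\mid w\notin\alpha\}$. For $G\in\mathrm{Min}$ crossing $(\alpha_1,\ldots,\alpha_k)$ let $\Phi(G)=\{\alpha_1,\ldots,\alpha_k\}$, ordered by $\alpha_1\leq_G\cdots\leq_G\alpha_k$ (so $\Phi(G)=\Phi(w)$ for $G\in\mathrm{Min}(w)$). Let $\mathcal{I}=\{(G,\alpha,\beta)\in\mathrm{Min}\times\Phi_+\times\Phi_+\mid\alpha,\beta\in\Phi(G),\ \alpha\leq_G\beta\}$. Given a family $(M_{\alpha,\beta}^G)_{(G,\alpha,\beta)\in\mathcal{I}}$ of subsets $M_{\alpha,\beta}^G\subseteq(\alpha,\beta)$ ordered via $\leq_G$, products $\prod_{\gamma\in M_{\alpha,\beta}^G}u_\gamma$ are taken in increasing order with respect to $\leq_G$, $[x,y]=x^{-1}y^{-1}xy$, and $U_w$ is the group with generators $u_\alpha$ ($\alpha\in\Phi(w)$)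 and relations $u_\alpha^2=1$ ($\alpha\in\Phi(w)$) and $[u_\alpha,u_\beta]=\prod_{\gamma\in M_{\alpha,\beta}^G}u_\gamma$ for all $(G,\alpha,\beta)\in\mathcal{I}$ with $G\in\mathrm{Min}(w)$. A commutator blueprint of type $(W,S)$ is such a family satisfying: (CB1) if $G=(c_0,\ldots,c_k)\in\mathrm{Min}$ and $H=(c_0,\ldots,c_m)$ with $1\leq m\leq k$, then $M_{\alpha,\beta}^H=M_{\alpha,\beta}^G$ for all $\alpha\leq_H\beta$ in $\Phi(H)$; (CB2) if $s\neq t\in S$, $m_{st}<\infty$, and $(G,\alpha,\beta)\in\mathcal{I}$ with $G\in\mathrm{Min}(r_{\{s,t\}})$, where $r_{\{s,t\}}$ is the longest element of $\langle s,t\rangle$, then $M_{\alpha,\beta}^G=(\alpha,\beta)$ if $\{\alpha,\beta\}=\{\alpha_s,\alpha_t\}$ and $M_{\alpha,\beta}^G=\emptyset$ otherwise; (CB3) $|U_w|=2^{\ell(w)}$ for all $w\in W$. It is Weyl-invariant if $M_{s\alpha,s\beta}^{sG}=\{s\gamma\mid\gamma\in M_{\alpha,\beta}^G\}$ for all $w\in W$, $s\in S$, $G\in\mathrm{Min}_s(w)$ and $\alpha\leq_G\beta$ in $\Phi(G)\setminus\{\alpha_s\}$. The family $\mathcal{M}(s_0,s_1)=(M(s_0,s_1)_{\alpha,\beta}^G)_{(G,\alpha,\beta)\in\mathcal{I}}$. Let $(G,\alpha,\beta)\in\mathcal{I}$ and suppose there is a minimal gallery $H=(c_0,\ldots,c_k)$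 of alternating type $(s,t,s,t,\ldots)$ (of length $k$) between $\alpha$ and $\beta$, crossing $(\alpha_1=\alpha,\ldots,\alpha_k=\beta)$. Then: if $k=4$, $s=s_0$, $t=s_1$: $M(s_0,s_1)_{\alpha,\beta}^G=\{\alpha_2,\alpha_3\}$; if $k=5$, $s=s_0$, $t=s_1$: $M(s_0,s_1)_{\alpha,\beta}^G=\{\alpha_2,\alpha_3\}$; if $k=5$, $s=s_1$, $t=s_0$: $M(s_0,s_1)_{\alpha,\beta}^G=\{\alpha_3,\alpha_4\}$; if $k=6$, $s=s_1$, $t=s_0$: $M(s_0,s_1)_{\alpha,\beta}^G=\{\alpha_3,\alpha_4\}$. In all other cases $M(s_0,s_1)_{\alpha,\beta}^G=\emptyset$. The groups $U_w$ are those associated with this family. *)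

(* Defs.v *)
From HB Require Import structures.
From mathcomp Require Import all_boot finmap.
From mathcomp Require Import boolp classical_sets functions cardinality.

Set Implicit Arguments.
Unset Strict Implicit.
Unset Printing Implicit Defensive.

Local Open Scope classical_set_scope.
Local Open Scope group_scope.
Local Open Scope quotient_scope.

(** * Groups given by generators and relations *)

(* A letter (b, x) stands for x if b = false and for x^-1 if b = true. *)
Definition word (X : choiceType) := seq (bool * X).

Definition gen_word (X : choiceType) (x : X) : word X := [:: (false, x)].

Definition winv (X : choiceType) (u : word X) : word X :=
  rev [seq (~~ l.1, l.2) | l <- u].

Definition wcomm (X : choiceType) (u v : word X) : word X :=
  winv u ++ winv v ++ u ++ v.

(* The congruence on words generated by free cancellation and by the
   relations u = v for R u v. *)
Inductive wcong (X : choiceType) (R : word X -> word X -> Prop) :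
    word X -> word X -> Prop :=
| wcong_rel u v : R u v -> wcong R u v
| wcong_cancel b x : wcong R [:: (b, x); (~~ b, x)] [::]
| wcong_refl u : wcong R u u
| wcong_sym u v : wcong R u v -> wcong R v u
| wcong_trans v u w : wcong R u v -> wcong R v w -> wcong R u w
| wcong_cat u u' v v' : wcong R u u' -> wcong R v v' ->
    wcong R (u ++ v) (u' ++ v').

Definition wcongb (X : choiceType) (R : word X -> word X -> Prop) :
    rel (word X) := fun u v => `[< wcong R u v >].

Lemma wcongb_refl (X : choiceType) (R : word X -> word X -> Prop) :
  reflexive (wcongb R).
Proof. by move=> u; apply/asboolP/wcong_refl. Qed.

Lemma wcongb_sym (X : choiceType) (R : word X -> word X -> Prop) :
  symmetric (wcongb R).
Proof.
by move=> u v; apply/idP/idP => /asboolP uv; apply/asboolP/wcong_sym.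
Qed.

Lemma wcongb_trans (X : choiceType) (R : word X -> word X -> Prop) :
  transitive (wcongb R).
Proof.
move=> v u w /asboolP uv /asboolP vw.
by apply/asboolP/(wcong_trans uv vw).
Qed.

Canonical wcongb_equiv (X : choiceType) (R : word X -> word X -> Prop) :=
  EquivRel (wcongb R) (wcongb_refl R) (wcongb_sym R) (@wcongb_trans X R).

Definition presented (X : choiceType) (R : word X -> word X -> Prop) : Type :=
  {eq_quot wcongb_equiv R}.

HB.instance Definition _ (X : choiceType) (R : word X -> word X -> Prop) :=
  Choice.on (presented R).
HB.instance Definition _ (X : choiceType) (R : word X -> word X -> Prop) :=
  EqQuotient.on (presented R).

Definition wclass (X : choiceType) (R : word X -> word X -> Prop)
  (u : word X) : presented R := \pi_(presented R) u.

Lemma wclassP (X : choiceType) (R : word X -> word X -> Prop) (u v : word X) :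
  wclass R u = wclass R v <-> wcong R u v.
Proof.
split => [/eqquotP/asboolP //|uv].
by apply/eqquotP/asboolP.
Qed.

Lemma wclass_repr (X : choiceType) (R : word X -> word X -> Prop)
  (x : presented R) : wclass R (repr x) = x.
Proof. exact: reprK. Qed.

Definition pmul (X : choiceType) (R : word X -> word X -> Prop)
  (x y : presented R) : presented R := wclass R (repr x ++ repr y).

Definition pinv (X : choiceType) (R : word X -> word X -> Prop)
  (x : presented R) : presented R := wclass R (winv (repr x)).

Lemma pmul_class (X : choiceType) (R : word X -> word X -> Prop) u v :
  pmul (wclass R u) (wclass R v) = wclass R (u ++ v).
Proof. by apply/wclassP/wcong_cat; apply/wclassP/wclass_repr. Qed.

Lemma wcong_winv (X : choiceType) (R : word X -> word X -> Prop) u :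
  wcong R (u ++ winv u) [::].
Proof.
elim: u => [|[b x] u IHu]; first exact: wcong_refl.
rewrite /winv map_cons rev_cons -cats1 -cat1s -catA (catA u).
apply: wcong_trans (wcong_cancel R b x); rewrite -[X in wcong R _ X]cat1s.
apply: wcong_cat; first exact: wcong_refl.
rewrite -[X in wcong R _ X]cat0s.
by apply: wcong_cat => //; apply: wcong_refl.
Qed.

Lemma winvK (X : choiceType) : involutive (@winv X).
Proof.
move=> u; rewrite /winv map_rev revK -map_comp -[RHS]map_id.
by apply: eq_map => -[b x] /=; rewrite negbK.
Qed.

Lemma wcong_invw (X : choiceType) (R : word X -> word X -> Prop) u :
  wcong R (winv u ++ u) [::].
Proof. by have := wcong_winv R (winv u); rewrite winvK. Qed.

Lemma pmulA (X : choiceType) (R : word X -> word X -> Prop) :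
  associative (@pmul X R).
Proof.
move=> x y z; rewrite -[x]wclass_repr -[y]wclass_repr -[z]wclass_repr.
by rewrite !pmul_class catA.
Qed.

Lemma pmul1 (X : choiceType) (R : word X -> word X -> Prop) :
  left_id (wclass R [::]) (@pmul X R).
Proof. by move=> x; rewrite -[x]wclass_repr pmul_class. Qed.

Lemma pmulr1 (X : choiceType) (R : word X -> word X -> Prop) :
  right_id (wclass R [::]) (@pmul X R).
Proof. by move=> x; rewrite -[x]wclass_repr pmul_class cats0. Qed.

Lemma pmulV (X : choiceType) (R : word X -> word X -> Prop) :
  left_inverse (wclass R [::]) (@pinv X R) (@pmul X R).
Proof.
move=> x; rewrite -[x in pmul _ x]wclass_repr /pinv pmul_class.
exact/wclassP/wcong_invw.
Qed.

Lemma pmulrV (X : choiceType) (R : word X -> word X -> Prop) :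
  right_inverse (wclass R [::]) (@pinv X R) (@pmul X R).
Proof.
move=> x; rewrite -[x in pmul x _]wclass_repr /pinv pmul_class.
exact/wclassP/wcong_winv.
Qed.

HB.instance Definition _ (X : choiceType) (R : word X -> word X -> Prop) :=
  isGroup.Build (presented R) (@pmulA X R) (@pmul1 X R) (@pmulr1 X R)
    (@pmulV X R) (@pmulrV X R).

Definition pgen (X : choiceType) (R : word X -> word X -> Prop) (x : X) :
  presented R := wclass R (gen_word x).

(** * Subgroups and the lower central series *)

Definition is_subgroup (G : groupType) (A : set G) : Prop :=
  [/\ A 1, forall x y, A x -> A y -> A (x * y) & forall x, A x -> A x^-1].

Definition generated (G : groupType) (A : set G) : set G :=
  smallest (@is_subgroup G) A.

Fixpoint lower_central (G : groupType) (n : nat) : set G :=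
  if n is m.+1 then
    generated [set z | exists x y, @lower_central G m x /\ z = [~ x, y]]
  else setT.

Definition nilpotent_class_le (G : groupType) (n : nat) : Prop :=
  @lower_central G n = [set 1].

(** * Coxeter systems *)

Definition has_order (W : groupType) (x : W) (n : nat) : Prop :=
  [/\ (0 < n)%N, x ^+ n = 1 & forall m, (0 < m < n)%N -> x ^+ m <> 1].

Definition finite_order (W : groupType) (x : W) : Prop :=
  exists n, has_order x n.

Definition coxeter_rel (W : groupType) (S : {fset W}) (u v : word S) : Prop :=
  exists (s t : S) (n : nat), has_order (val s * val t) n /\
    u = flatten (nseq n (gen_word s ++ gen_word t)) /\ v = [::].

(* S consists of involutions and W is presented by <S | (st)^{m_st}>;
   the case s = t, m_ss = 1 yields the relations s^2 = 1. *)
Definition coxeter_system (W : groupType) (S : {fset W}) : Prop :=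
  (forall s, s \in S -> s <> 1 /\ s * s = 1) /\
  exists f : presented (@coxeter_rel W S) -> W,
    [/\ {morph f : x y / x * y},
        forall s : S, f (pgen (@coxeter_rel W S) s) = val s & bijective f].

Definition universal_type (W : groupType) (S : {fset W}) : Prop :=
  forall s t, s \in S -> t \in S -> s <> t -> ~ finite_order (s * t).

(* w is a product of n elements of S (all of which are involutions). *)
Definition is_word_product (W : groupType) (S : {fset W}) (w : W) (n : nat) :=
  exists l : seq W, [/\ {subset l <= S}, size l = n & w = \prod_(s <- l) s].

Definition cox_length (W : groupType) (S : {fset W}) (w : W) : nat :=
  xget 0%N [set n | is_word_product S w n /\
                    forall m, is_word_product S w m -> (n <= m)%N].

(** * Galleries *)

Definition gallery_type (W : groupType) (G : seq W) : seq W :=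
  if G is c :: G' then pairmap (fun v w => v^-1 * w) c G' else [::].

(* A gallery (c_0, ..., c_n) is a nonempty sequence of n + 1 chambers. *)
Definition is_gallery (W : groupType) (S : {fset W}) (G : seq W) : Prop :=
  G <> [::] /\ {subset gallery_type G <= S}.

Definition minimal_gallery (W : groupType) (S : {fset W}) (G : seq W) : Prop :=
  is_gallery S G /\ cox_length S ((head 1 G)^-1 * last 1 G) = (size G).-1.

Definition Min (W : groupType) (S : {fset W}) : set (seq W) :=
  [set G | minimal_gallery S G /\ head 1 G = 1].

Definition Min_to (W : groupType) (S : {fset W}) (w : W) : set (seq W) :=
  [set G | Min S G /\ last 1 G = w].

Definition Min_s (W : groupType) (S : {fset W}) (s w : W) : set (seq W) :=
  [set G | Min_to S w G /\
           (cox_length S w = (cox_length S (s * w)).+1 ->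
            exists l, gallery_type G = s :: l)].

Definition gallery_act (W : groupType) (S : {fset W}) (s : W) (G : seq W) :
    seq W :=
  let w := last 1 G in
  if cox_length S w == (cox_length S (s * w)).+1
  then [seq s * c | c <- behead G]
  else 1 :: [seq s * c | c <- G].

(** * Roots *)

Definition lmul (W : groupType) (v : W) (A : set W) : set W :=
  [set v * x | x in A].

Definition simple_root (W : groupType) (S : {fset W}) (s : W) : set W :=
  [set w | (cox_length S w < cox_length S (s * w))%N].

Definition roots (W : groupType) (S : {fset W}) : set (set W) :=
  [set alpha | exists v s, s \in S /\ alpha = lmul v (simple_root S s)].

Definition pos_roots (W : groupType) (S : {fset W}) : set (set W) :=
  [set alpha | roots S alpha /\ alpha 1].

Definition inversions (W : groupType) (S : {fset W}) (w : W) : set (set W) :=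
  [set alpha | pos_roots S alpha /\ ~ alpha w].

(* Only used for prenilpotent pairs; any two roots crossed by a common
   minimal gallery form such a pair. *)
Definition closed_interval (W : groupType) (S : {fset W})
    (alpha beta : set W) : set (set W) :=
  [set gamma | [/\ roots S gamma, alpha `&` beta `<=` gamma &
                   ~` alpha `&` ~` beta `<=` ~` gamma]].

Definition open_interval (W : groupType) (S : {fset W})
    (alpha beta : set W) : set (set W) :=
  closed_interval S alpha beta `\` [set alpha; beta].

(* For adjacent chambers v and w there is exactly one such root. *)
Definition separating_root (W : groupType) (S : {fset W}) (v w : W) : set W :=
  xget set0 [set alpha | [/\ roots S alpha, alpha v & ~ alpha w]].

Definition crossed (W : groupType) (S : {fset W}) (G : seq W) : seq (set W) :=
  if G is c :: G' then pairmap (separating_root S) c G' else [::].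

Definition gallery_le (W : groupType) (S : {fset W}) (G : seq W)
    (alpha beta : set W) : Prop :=
  [/\ alpha \in crossed S G, beta \in crossed S G &
      (index alpha (crossed S G) <= index beta (crossed S G))%N].

(** * Commutator blueprints *)

Definition index_triple (W : groupType) (S : {fset W}) (G : seq W)
    (alpha beta : set W) : Prop :=
  [/\ Min S G, pos_roots S alpha, pos_roots S beta &
      gallery_le S G alpha beta].

(* Families are total functions; only their values at index triples matter. *)
Definition root_family (W : groupType) :=
  seq W -> set W -> set W -> set (set W).

(* The word prod_{gamma in A} u_gamma, in the order in which G crosses the
   roots; insub drops no root when G is a minimal gallery from 1 to w. *)
Definition gallery_prod (W : groupType) (S : {fset W}) (w : W) (G : seq W)
    (A : set (set W)) : word (inversions S w) :=
  flatten [seq gen_word g |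
    g <- pmap (insub : set W -> option (inversions S w))
              [seq gamma <- crossed S G | gamma \in A]].

Definition U_rel (W : groupType) (S : {fset W}) (M : root_family W) (w : W)
    (u v : word (inversions S w)) : Prop :=
  (exists a : inversions S w, u = gen_word a ++ gen_word a /\ v = [::]) \/
  (exists (G : seq W) (a b : inversions S w),
     [/\ Min_to S w G, index_triple S G (val a) (val b),
         u = wcomm (gen_word a) (gen_word b) &
         v = gallery_prod S w G (M G (val a) (val b))]).

Definition U (W : groupType) (S : {fset W}) (M : root_family W) (w : W) :
  groupType := presented (@U_rel W S M w).

Definition CB1 (W : groupType) (S : {fset W}) (M : root_family W) : Prop :=
  forall (G : seq W) (m : nat), Min S G -> (1 <= m < size G)%N ->
  forall alpha beta, index_triple S (take m.+1 G) alpha beta ->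
  M (take m.+1 G) alpha beta = M G alpha beta.

Definition is_longest (W : groupType) (S : {fset W}) (A : set W) (r : W) :=
  A r /\ forall v, A v -> (cox_length S v <= cox_length S r)%N.

Definition CB2 (W : groupType) (S : {fset W}) (M : root_family W) : Prop :=
  forall s t, s \in S -> t \in S -> s <> t -> finite_order (s * t) ->
  forall r, is_longest S (generated [set s; t]) r ->
  forall G alpha beta, index_triple S G alpha beta -> Min_to S r G ->
  ([set alpha; beta] = [set simple_root S s; simple_root S t] ->
     M G alpha beta = open_interval S alpha beta) /\
  ([set alpha; beta] <> [set simple_root S s; simple_root S t] ->
     M G alpha beta = set0).

Definition CB3 (W : groupType) (S : {fset W}) (M : root_family W) : Prop :=
  forall w, ([set: U S M w] #= `I_((2 ^ cox_length S w)%N))%card.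

Definition commutator_blueprint (W : groupType) (S : {fset W})
    (M : root_family W) : Prop :=
  [/\ forall G alpha beta, index_triple S G alpha beta ->
        M G alpha beta `<=` open_interval S alpha beta,
      CB1 S M, CB2 S M & CB3 S M].

Definition weyl_invariant (W : groupType) (S : {fset W})
    (M : root_family W) : Prop :=
  forall w s G, s \in S -> Min_s S s w G ->
  forall alpha beta, gallery_le S G alpha beta ->
  alpha <> simple_root S s -> beta <> simple_root S s ->
  M (gallery_act S s G) (lmul s alpha) (lmul s beta) =
  [set lmul s gamma | gamma in M G alpha beta].

(** * The family M(s_0, s_1) *)

Definition alternating_gallery_between (W : groupType) (S : {fset W})
    (s t : W) (H : seq W) (alpha beta : set W) : Prop :=
  [/\ minimal_gallery S H, (1 < size H)%N,
      gallery_type H = mkseq (fun i => if odd i then t else s) (size H).-1 &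
      head set0 (crossed S H) = alpha /\ last set0 (crossed S H) = beta].

(* Here c = (alpha_1, ..., alpha_k) is indexed from 0 by nth. *)
Definition calM_value (W : groupType) (s0 s1 s t : W) (c : seq (set W)) :
    set (set W) :=
  let k := size c in let alpha_ i := nth set0 c i.-1 in
  if [&& k == 4, s == s0 & t == s1] then [set alpha_ 2; alpha_ 3]
  else if [&& k == 5, s == s0 & t == s1] then [set alpha_ 2; alpha_ 3]
  else if [&& k == 5, s == s1 & t == s0] then [set alpha_ 3; alpha_ 4]
  else if [&& k == 6, s == s1 & t == s0] then [set alpha_ 3; alpha_ 4]
  else set0.

(* In universal type there is at most one alternating minimal gallery between
   two given roots, so that the union below is the value prescribed by that
   gallery, and is empty if there is none. *)
Definition calM (W : groupType) (S : {fset W}) (s0 s1 : W) : root_family W :=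
  fun _ alpha beta =>
    [set gamma | exists s t H, alternating_gallery_between S s t H alpha beta /\
                               calM_value s0 s1 s t (crossed S H) gamma].

(* Main.v *)
(* In universal type the Cayley graph of W is a tree whose half-trees are the
   roots, so Min(w) is a single gallery, crossing a chain r_0 < ... < r_{n-1}
   of positive roots along the reduced word l_0 ... l_{n-1} of w.  Whenever
   l_q ... l_{q+3} = s_0 s_1 s_0 s_1, the value {r_{q+1}, r_{q+2}} is attained
   exactly at the pairs (r_i, r_j) joined by an alternating subword with
   i in {q - 1, q} and j in {q + 3, q + 4}.  A generator not commuting
   with one factor of z_q = u_{q+1} u_{q+2} therefore has the same commutator
   with the other factor, so z_q is central and U_w has class at most 2.

   Every element of U_w is an ordered product of the generators, which bounds
   |U_w| by 2^n.  For the lower bound, U_w is mapped to a central extension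
   with underlying set F_2[X], where u_i goes to X^i and the cocycle is
   f(x, y) = sum_q lam_q(x) mu_q(y) (X^{q+1} + X^{q+2}) for linear forms lam_q
   and mu_q vanishing on all X^{p+1} + X^{p+2}; distinct ordered products have
   distinct images. *)

Require Import Defs.
From HB Require Import structures.
From mathcomp Require Import all_boot finmap all_algebra.
From mathcomp Require Import boolp classical_sets functions cardinality zify.

Set Implicit Arguments.
Unset Strict Implicit.
Unset Printing Implicit Defensive.

(** * Presented groups *)

Section Presented.
Local Open Scope group_scope.
Variables (X : choiceType) (R : word X -> word X -> Prop).

Definition weval (E : groupType) (phi : X -> E) (u : word X) : E :=
  \prod_(l <- u) (if l.1 then (phi l.2)^-1 else phi l.2).

Lemma weval_cat (E : groupType) (phi : X -> E) u v :
  weval phi (u ++ v) = weval phi u * weval phi v.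
Proof. by rewrite /weval big_cat. Qed.

Lemma weval_gen (E : groupType) (phi : X -> E) x :
  weval phi (gen_word x) = phi x.
Proof. by rewrite /weval big_seq1. Qed.

Lemma weval_winv (E : groupType) (phi : X -> E) u :
  weval phi (winv u) = (weval phi u)^-1.
Proof.
elim: u => [|[b x] u IHu]; first by rewrite /weval !big_nil invg1.
rewrite /winv map_cons rev_cons -cats1 weval_cat -/(winv u) IHu.
rewrite -[(b, x) :: u]cat1s weval_cat invgM; congr (_ * _).
by rewrite /weval !big_seq1 /=; case: b; rewrite ?invgK.
Qed.

Lemma weval_wcomm (E : groupType) (phi : X -> E) u v :
  weval phi (wcomm u v) = [~ weval phi u, weval phi v].
Proof. by rewrite /wcomm !weval_cat !weval_winv commgEl conjgE. Qed.

Lemma wcong_weval (E : groupType) (phi : X -> E) :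
  (forall u v, R u v -> weval phi u = weval phi v) ->
  forall u v, wcong R u v -> weval phi u = weval phi v.
Proof.
move=> phiR u v; elim=> {u v} [u v /phiR //|b x|//|//||].
- by rewrite /weval big_cons big_seq1 big_nil; case: b => /=;
    rewrite ?mulVg ?mulgV.
- by move=> u v w _ -> _ ->.
- by move=> u u' v v' _ e1 _ e2; rewrite !weval_cat e1 e2.
Qed.

(** The map of the universal property of the presentation. It is defined through a chosen
    representative, so it is a homomorphism only once [phi] respects the relations, the hypothesis
    [phiR] below. *)
Definition plift (E : groupType) (phi : X -> E) (x : presented R) : E :=
  weval phi (repr x).

Section Lift.
Variables (E : groupType) (phi : X -> E).
Hypothesis phiR : forall u v, R u v -> weval phi u = weval phi v.

Lemma plift_class u : plift phi (wclass R u) = weval phi u.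
Proof. by apply: (wcong_weval phiR); apply/wclassP/wclass_repr. Qed.

Lemma pliftM : {morph plift phi : x y / x * y}.
Proof.
move=> x y; rewrite -[x]wclass_repr -[y]wclass_repr.
by rewrite [_ * _]pmul_class !plift_class weval_cat.
Qed.

End Lift.

Lemma wclassM u v : wclass R (u ++ v) = wclass R u * wclass R v.
Proof. by rewrite [RHS]pmul_class. Qed.

Lemma wclassE u : wclass R u = weval (pgen R) u.
Proof.
have wclassV v : wclass R (winv v) = (wclass R v)^-1.
  by apply/esym/mulg1_eq; rewrite -wclassM; apply/wclassP/wcong_winv.
elim: u => [|[b x] u IHu]; first by rewrite /weval big_nil.
rewrite -[(b, x) :: u]cat1s wclassM weval_cat IHu; congr (_ * _).
by rewrite /weval big_seq1 /=; case: b => //; rewrite -wclassV.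
Qed.

End Presented.

(** * Nilpotency of class at most two *)

Section Subgroups.
Local Open Scope group_scope.
Local Open Scope classical_set_scope.
Variable G : groupType.

Lemma generated_sub (A B : set G) :
  is_subgroup B -> A `<=` B -> generated A `<=` B.
Proof. by move=> HB AB x; apply. Qed.

(** If all commutators are central, so is the subgroup they generate, because the centre is a
    subgroup; the next term of the series is then generated by trivial commutators. *)
Lemma nilpotent_class2 :
  (forall x y z : G, [~ [~ x, y], z] = 1) -> nilpotent_class_le G 2.
Proof.
move=> G2; apply/seteqP; split=> [|x ->]; last by move=> B [] [].
have centG : is_subgroup [set x : G | forall z, commute x z].
  split=> [z|x y cx cy z|x cx z]; apply/commute_sym.
  - exact: commute1.
  - by apply: commuteM; apply/commute_sym.
  - by apply/commuteV/commute_sym.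
apply: (@generated_sub _ [set 1]) => [|z [x [y [x1 ->]]]].
  by split=> [//|x y -> ->|x ->] /=; rewrite ?mulg1 ?invg1.
apply/eqP/commgP; apply: (generated_sub centG _ x1 y) => _ [u [v [_ ->]]] z'.
exact/commgP/eqP.
Qed.

End Subgroups.

(** * Ordered products *)

Section OrderedProducts.
Local Open Scope group_scope.
Variables (G : groupType) (u : nat -> G).

(** Exponents are Booleans because the generators will be involutions; the bit vector [b] plays the
    part of a normal form. *)
Definition oprod (b : nat -> bool) k : G := \prod_(0 <= i < k) u i ^+ b i.

Definition is_oprod k : set G := [set oprod b k | b in setT]%classic.

Lemma oprodS b k : oprod b k.+1 = oprod b k * u k ^+ b k.
Proof. by rewrite /oprod big_nat_recr. Qed.

Lemma eq_oprod b b' k : (forall i, i < k -> b i = b' i) ->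
  oprod b k = oprod b' k.
Proof. by move=> eqb; apply: eq_big_nat => i /eqb ->. Qed.

Lemma is_oprodS k (e : bool) x : is_oprod k x -> is_oprod k.+1 (x * u k ^+ e).
Proof.
case=> b _ <-; exists (fun i => if i == k then e else b i) => //.
rewrite oprodS eqxx; congr (_ * _); apply: eq_oprod => i ltik.
by rewrite (ltn_eqF ltik).
Qed.

Lemma is_oprod1 k : is_oprod k 1.
Proof.
by exists (fun=> false) => //; rewrite /oprod big1.
Qed.

Lemma is_oprod_le k l x : k <= l -> is_oprod k x -> is_oprod l x.
Proof.
move=> /subnK <-; elim: (l - k) => [|m IHm] // /IHm /(is_oprodS false).
by rewrite expg0 mulg1.
Qed.

Lemma is_oprod_gen k i : i < k -> is_oprod k (u i).
Proof.
move=> ltik; apply: is_oprod_le ltik _.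
by have := is_oprodS true (is_oprod1 i); rewrite mul1g.
Qed.

Variable n : nat.
Hypothesis u2 : forall i, i < n -> u i * u i = 1.
Hypothesis ucomm : forall i k, i < k -> k < n -> is_oprod k [~ u i, u k].

(* Each u_k normalises the group generated by its predecessors. *)
Lemma is_oprodM k x y :
  k <= n -> is_oprod k x -> is_oprod k y -> is_oprod k (x * y).
Proof.
elim: k x y => [|k IHk] x y lekn.
  by case=> b _ <- [c _ <-]; rewrite /oprod !big_geq // mulg1; apply: is_oprod1.
have conjP z : is_oprod k z -> is_oprod k (z ^ u k).
  case=> b _ <-; rewrite /oprod conjg_prod big_seq.
  elim/big_rec: _ => [|i w]; first exact: is_oprod1.
  rewrite mem_index_iota => /andP[_ ltik] Pw; apply: (IHk _ _ (ltnW lekn)) Pw.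
  rewrite conjXg; case: (b i); last exact: is_oprod1.
  (* The conjugate of [u i] is [u i * [~ u i, u k]], and [ucomm] puts the commutator among the
     ordered products of earlier generators. *)
  rewrite expg1 -(mulVKg (u i) (u i ^ u k)) -commgEl.
  by apply: (IHk) (ltnW lekn) (is_oprod_gen ltik) (ucomm ltik lekn).
case=> b _ <- [c _ <-]; rewrite !oprodS.
have P1 : is_oprod k (oprod b k) by exists b.
have P2 : is_oprod k (oprod c k) by exists c.
have ukV : (u k)^-1 = u k by apply: mulg1_eq; apply: u2.
case: (b k); last first.
  by rewrite expg0 mulg1 mulgA; apply/is_oprodS/IHk/P2/P1/ltnW.
(* Moving [u k] to the right conjugates the second factor; the two powers of [u k] then merge, which
   flips the bit [c k]. *)
rewrite expg1; have -> : oprod b k * u k * (oprod c k * u k ^+ c k) =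
    oprod b k * oprod c k ^ u k * u k ^+ ~~ c k.
  rewrite conjgE ukV -!mulgA; congr (_ * (_ * (_ * _))).
  by case: (c k); rewrite /= ?expg1 ?expg0 ?mulg1 // u2.
by apply/is_oprodS/IHk/conjP/P2/P1/ltnW.
Qed.

End OrderedProducts.

(** * Central extensions by a bilinear cocycle *)

Import GRing.Theory.

(** A biadditive map whose values lie in both of its radicals. The radical conditions make the
    values central in the extension, hence the class at most two. *)
Record cocycle (V : zmodType) := Cocycle {
  cocycle_fun :> V -> V -> V;
  cocycleDl : forall x y z,
    (cocycle_fun (x + y) z = cocycle_fun x z + cocycle_fun y z)%R;
  cocycleDr : forall x y z,
    (cocycle_fun x (y + z) = cocycle_fun x y + cocycle_fun x z)%R;
  cocycle_l0 : forall x y z, cocycle_fun (cocycle_fun x y) z = 0%R;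
  cocycle_r0 : forall x y z, cocycle_fun x (cocycle_fun y z) = 0%R }.

(** An alias of [V] indexed by [f], so that each cocycle has its own multiplicative group
    structure. *)
Definition cext (V : zmodType) (f : cocycle V) : Type := V.

Section CentralExtension.
Local Open Scope ring_scope.
Variables (V : zmodType) (f : cocycle V).

Lemma cocycle0l x : f 0 x = 0.
Proof. by apply: (addrI (f 0 x)); rewrite -cocycleDl !addr0. Qed.

Lemma cocycle0r x : f x 0 = 0.
Proof. by apply: (addrI (f x 0)); rewrite -cocycleDr !addr0. Qed.

Lemma cocycleNl x y : f (- x) y = - f x y.
Proof. by apply: (addrI (f x y)); rewrite -cocycleDl !subrr cocycle0l. Qed.

Lemma cocycleNr x y : f x (- y) = - f x y.
Proof. by apply: (addrI (f x y)); rewrite -cocycleDr !subrr cocycle0r. Qed.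

Definition cext_mul (x y : cext f) : cext f := (x : V) + y + f x y.
Definition cext_inv (x : cext f) : cext f := - (x : V) + f x x.

Let cextE :=
  (cocycleDl, cocycleDr, cocycleNl, cocycleNr, cocycle_l0, cocycle_r0).

Lemma cext_mulA : associative cext_mul.
Proof.
move=> x y z; rewrite /cext_mul !cextE !addr0 -!addrA; congr (_ + (_ + _)).
by rewrite addrCA [RHS]addrCA [f y z + _]addrC !addrA.
Qed.

Lemma cext_mul1 : left_id (0 : cext f) cext_mul.
Proof. by move=> x; rewrite /cext_mul cocycle0l add0r addr0. Qed.

Lemma cext_mulr1 : right_id (0 : cext f) cext_mul.
Proof. by move=> x; rewrite /cext_mul cocycle0r !addr0. Qed.

Lemma cext_mulV : left_inverse (0 : cext f) cext_inv cext_mul.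
Proof.
move=> x; rewrite /cext_mul /cext_inv !cextE !addr0.
by rewrite (addrAC (- (x : V))) addNr add0r subrr.
Qed.

Lemma cext_mulrV : right_inverse (0 : cext f) cext_inv cext_mul.
Proof.
by move=> x; rewrite /cext_mul /cext_inv !cextE !addr0 addrA subrr add0r subrr.
Qed.

HB.instance Definition _ := Choice.copy (cext f) V.
HB.instance Definition _ := isGroup.Build (cext f)
  cext_mulA cext_mul1 cext_mulr1 cext_mulV cext_mulrV.

Lemma cextM (x y : cext f) : (x * y)%g = (x : V) + y + f x y.
Proof. by []. Qed.

(** Compare [x * y] with [y * x] times the claimed value: that value lies in the radicals, so
    multiplying by it is plain addition. *)
Lemma cext_comm (x y : cext f) : [~ x, y]%g = f x y - f y x.
Proof.
apply: (mulgI (y * x)%g); rewrite -commgC !cextM !cextE !subrr !addr0.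
by rewrite -[RHS]addrA [f y x + _]addrC subrK [in LHS](addrC (x : V)).
Qed.

Lemma cext_comm2 (x y z : cext f) : [~ [~ x, y], z]%g = 1%g.
Proof. by rewrite !cext_comm !cextE !subrr. Qed.

End CentralExtension.

(** * A model for the groups U_w *)

Section Model.
Local Open Scope ring_scope.
Variables (T : eqType) (a b : T) (ts : nat -> T) (n : nat).
Hypothesis neq_ab : a != b.

(** Later [a], [b] are [s0], [s1] and [ts] lists the letters of a reduced word, so a core is an
    occurrence of [s0 s1 s0 s1]. *)
Definition core q :=
  [&& ts q == a, ts q.+1 == b, ts q.+2 == a & ts q.+3 == b].

Definition core_of i := if ts i == a then i else i.+1.

(* The pairs i < j with non-trivial commutator u_{q+1} u_{q+2}, where
   q = core_of i: if ts i = b, the core can only start one step later. *)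
Definition linked i j :=
  let q := core_of i in
  [&& core q, (ts i == a) || (ts i == b) &
      (j == q.+3) || (j == q.+4) && (ts j == a)].

(* mu_q detects the i and lam_q the j with core_of i = q and linked i j; they
   vanish on zz r because they see both of its terms or neither. *)
Let lam q (x : {poly 'F_2}) : 'F_2 := x`_q.+3 + (ts q.+4 == a)%:R * x`_q.+4.
Let mu q (x : {poly 'F_2}) : 'F_2 := x`_q + (ts q.-1 == b)%:R * x`_q.-1.
Let zz q : {poly 'F_2} := 'X^(q.+1) + 'X^(q.+2).

Definition model_fun (x y : {poly 'F_2}) : {poly 'F_2} :=
  \sum_(q < n | core q) (lam q x * mu q y) *: zz q.

Let F2_2 : (1 + 1 = 0 :> 'F_2). Proof. exact/val_inj. Qed.

Let lamD q x y : lam q (x + y) = lam q x + lam q y.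
Proof. by rewrite /lam !coefD mulrDr addrACA. Qed.

Let muD q x y : mu q (x + y) = mu q x + mu q y.
Proof. by rewrite /mu !coefD mulrDr addrACA. Qed.

Let lamZ q c x : lam q (c *: x) = c * lam q x.
Proof. by rewrite /lam !coefZ mulrDr mulrCA. Qed.

Let muZ q c x : mu q (c *: x) = c * mu q x.
Proof. by rewrite /mu !coefZ mulrDr mulrCA. Qed.

Let neq_ts i j : ts i = a -> ts j = b -> (i == j) = false.
Proof. by move=> ia jb; apply/eqP => ij; move: neq_ab; rewrite -ia -jb ij eqxx. Qed.

(** The exponents [r.+1], [r.+2] can meet [q.+3], [q.+4] only for [r = q.+1], [q.+2] or [q.+3]. The
    letters exclude the first and the last; for [r = q.+2] both terms are seen, since [ts r.+2] is
    [a], and they cancel modulo 2. *)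
Let lam_zz q r : core q -> core r -> lam q (zz r) = 0.
Proof.
move=> /and4P[/eqP q0 /eqP q1 /eqP q2 /eqP q3].
move=> /and4P[/eqP r0 /eqP r1 /eqP r2 /eqP r3].
rewrite /lam /zz !coefD !coefXn !eqSS ![_ == r]eq_sym.
rewrite (neq_ts r0 q1) (neq_ts r0 q3) addr0 add0r.
have [eqr|_] := eqVneq r q.+2; last by rewrite mulr0 addr0.
by rewrite -eqr r2 eqxx mulr1 F2_2.
Qed.

Let mu_zz q r : core q -> core r -> mu q (zz r) = 0.
Proof.
move=> /and4P[/eqP q0 /eqP q1 /eqP q2 /eqP q3].
move=> /and4P[/eqP r0 /eqP r1 /eqP r2 /eqP r3].
rewrite /mu /zz !coefD !coefXn.
case: q => [|q] /= in q0 q1 q2 q3 *; first by rewrite !addr0 mulr0 addr0.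
rewrite (neq_ts q0 r1) add0r !eqSS.
have [->|_] := eqVneq q r.+1.
  by rewrite r1 eqxx mul1r (ltn_eqF (ltnSn _)) addr0 F2_2.
have [eqq|_] := eqVneq q r.+2; last by rewrite !add0r mulr0.
by have := neq_ts q0 r3; rewrite eqq eqxx.
Qed.

Let model_funDl x y z : model_fun (x + y) z = model_fun x z + model_fun y z.
Proof.
rewrite -big_split; apply: eq_bigr => q _.
by rewrite lamD mulrDl scalerDl.
Qed.

Let model_funDr x y z : model_fun x (y + z) = model_fun x y + model_fun x z.
Proof.
rewrite -big_split; apply: eq_bigr => q _.
by rewrite muD mulrDr scalerDl.
Qed.

Let lam_model q x y : core q -> lam q (model_fun x y) = 0.
Proof.
move=> qP; rewrite /model_fun; elim/big_rec: _ => [|r z rP zP].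
  by rewrite /lam !coef0 mulr0 addr0.
by rewrite lamD zP addr0 lamZ lam_zz ?mulr0.
Qed.

Let mu_model q x y : core q -> mu q (model_fun x y) = 0.
Proof.
move=> qP; rewrite /model_fun; elim/big_rec: _ => [|r z rP zP].
  by rewrite /mu !coef0 mulr0 addr0.
by rewrite muD zP addr0 muZ mu_zz ?mulr0.
Qed.

Let model_l0 x y z : model_fun (model_fun x y) z = 0.
Proof. by apply: big1 => q qP; rewrite lam_model // mul0r scale0r. Qed.

Let model_r0 x y z : model_fun x (model_fun y z) = 0.
Proof. by apply: big1 => q qP; rewrite mu_model // mulr0 scale0r. Qed.

Definition model_cocycle :=
  Cocycle model_funDl model_funDr model_l0 model_r0.

Definition model := cext model_cocycle.

Definition mgen i : model := 'X^i : {poly 'F_2}.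

(** Where [mu q] sees ['X^k], the form [lam q] reads coefficients of index at least [k.+3]. Thus the
    cocycle vanishes on monomials taken in increasing order, and only decreasing pairs contribute to
    commutators. *)
Let model_fun_Xn (x : {poly 'F_2}) k : (size x <= k.+1)%N -> model_fun x 'X^k = 0.
Proof.
move=> lexk; apply: big1 => -[q /= _] _; rewrite /mu !coefXn.
have [eqk|neqk] := boolP (q == k) => /=; last first.
  have [eqk|_] := eqVneq q.-1 k; last by rewrite mulr0 addr0 mulr0 scale0r.
  by rewrite /lam (@nth_default _ 0 x q.+3) ?(@nth_default _ 0 x q.+4) ?mulr0 ?addr0 ?mul0r
    ?scale0r //; apply: leq_trans lexk _; lia.
by rewrite /lam (@nth_default _ 0 x q.+3) ?(@nth_default _ 0 x q.+4) ?mulr0 ?addr0 ?mul0r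
    ?scale0r //; apply: leq_trans lexk _; lia.
Qed.

(** The two terms of [mu] correspond to the two branches of [core_of]; hence at most one core sees a
    given generator. *)
Let mu_Xn q i : core q ->
  mu q 'X^i = ((q == core_of i) && ((ts i == a) || (ts i == b)))%:R.
Proof.
move=> /and4P[/eqP q0 /eqP q1 _ _]; rewrite /mu !coefXn /core_of.
have [eqi|neqi] := eqVneq q i.
  (* At [i = 0] the truncated [q.-1] is again 0, and the second term of [mu] vanishes because [ts 0]
     is [a] and not [b]. *)
  rewrite {q}eqi in q0 q1 *; case: i q0 q1 => [|i] q0 q1.
    by rewrite /= q0 (negbTE neq_ab) mul0r addr0 !eqxx.
  by rewrite [i == _]ltn_eqF // mulr0 addr0 q0 !eqxx.
rewrite add0r; case: q => [|q] /= in q0 q1 neqi *.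
  rewrite (negbTE neqi) mulr0.
  by case: (eqVneq (ts i) a) => //=; rewrite (negbTE neqi).
have [eqi|neqi'] := eqVneq q i.
  rewrite eqi mulr1; case: (eqVneq (ts i) a) => [ia|_]; last by rewrite eqxx.
  by rewrite ia (negbTE neq_ab) -eqi eqi gtn_eqF.
rewrite mulr0; case: (eqVneq (ts i) a) => _ /=; first by rewrite (negbTE neqi).
by rewrite eqSS (negbTE neqi').
Qed.

Let model_fun_gen i j : (i < j < n)%N ->
  model_fun 'X^j 'X^i = if linked i j then zz (core_of i) else 0.
Proof.
move=> /andP[ltij ltjn]; rewrite /linked.
have mu0 q : core q -> q != core_of i -> mu q 'X^i = 0.
  by move=> qP neq; rewrite mu_Xn // (negbTE neq).
have [coreP|ncore] := boolP (core (core_of i)); last first.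
  rewrite /model_fun big1 // => q qP; rewrite mu0 ?mulr0 ?scale0r //.
  by apply: contraNneq ncore => <-.
have lamE : lam (core_of i) 'X^j =
    ((j == (core_of i).+3) || (j == (core_of i).+4) && (ts j == a))%:R.
  rewrite /lam !coefXn ![_ == j]eq_sym.
  have [->|_] := eqVneq j (core_of i).+3.
    by rewrite ltn_eqF // mulr0 addr0.
  rewrite add0r; have [->|_] := eqVneq j (core_of i).+4; last by rewrite mulr0.
  by rewrite mulr1.
(* A core outside the range of the sum could be linked only to an index beyond [n], whereas
   [j < n]. *)
have [ltqn|leqn] := ltnP (core_of i) n; last first.
  have /negbTE -> : ~~ ((j == (core_of i).+3) ||
      (j == (core_of i).+4) && (ts j == a)) by lia.
  rewrite andbF /model_fun big1 // => q qP; rewrite mu0 ?mulr0 ?scale0r //.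
  by rewrite ltn_eqF //; apply: leq_trans leqn.
rewrite /model_fun (bigD1 (Ordinal ltqn)) //= big1 => [|q /andP[qP neq]].
  rewrite mu_Xn // eqxx lamE addr0 -natrM mulnb andbC.
  by case: ifP => _; rewrite ?scale1r ?scale0r.
by rewrite mu0 ?mulr0 ?scale0r.
Qed.

Lemma mgen2 i : (mgen i * mgen i = 1)%g.
Proof.
rewrite cextM /= model_fun_Xn ?size_polyXn // addr0.
by rewrite -mulr2n -scaler_nat (_ : 2%:R = 0) ?scale0r //; apply/val_inj.
Qed.

(** Of the two terms of [cext_comm] the increasing one vanishes. The other gives [- zz q], which
    equals [zz q] modulo 2 and is also the group product of its two monomials. *)
Lemma mgen_comm i j : (i < j < n)%N -> [~ mgen i, mgen j]%g =
  (if linked i j then mgen (core_of i).+1 * mgen (core_of i).+2 else 1)%g.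
Proof.
move=> ltijn; rewrite cext_comm /= (model_fun_gen ltijn) model_fun_Xn; last first.
  by rewrite size_polyXn; lia.
case: ifP => _; last by rewrite subrr.
rewrite cextM /= model_fun_Xn ?size_polyXn // addr0 sub0r.
apply/eqP; rewrite -subr_eq0 -opprD oppr_eq0 -mulr2n -scaler_nat.
by rewrite (_ : 2%:R = 0) ?scale0r //; apply/val_inj.
Qed.

(** The cocycle vanishes at each step of an increasing product, so the group product is the sum in
    the polynomial ring and the exponents can be read off as coefficients. *)
Lemma oprod_mgen c k :
  oprod mgen c k = \poly_(i < k) (c i)%:R :> {poly 'F_2}.
Proof.
elim: k => [|k IHk]; first by rewrite /oprod big_geq // poly_def big_ord0.
have lek := size_poly k (fun i => (c i)%:R : 'F_2).
have -> : \poly_(i < k.+1) (c i)%:R =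
    \poly_(i < k) (c i)%:R + (c k)%:R *: 'X^k :> {poly 'F_2}.
  by rewrite !poly_def big_ord_recr.
rewrite oprodS cextM IHk expgb.
case: (c k); last by rewrite scale0r cocycle0r addr0.
by rewrite /= model_fun_Xn ?addr0 ?scale1r // ltnW.
Qed.

Lemma oprod_mgen_inj c c' k :
  oprod mgen c k = oprod mgen c' k -> forall i, (i < k)%N -> c i = c' i.
Proof.
rewrite !oprod_mgen => eqc i ltik.
have /(congr1 (fun p : {poly 'F_2} => p`_i)) := eqc.
by rewrite !coef_poly ltik; case: (c i); case: (c' i).
Qed.

End Model.

(** * Order and class of a group that maps to the model *)

Section ModelIso.
Local Open Scope group_scope.
Variables (T : eqType) (a b : T) (ts : nat -> T) (n : nat).
Hypothesis neq_ab : a != b.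
Variables (G : groupType) (u : nat -> G) (phi : G -> model ts n neq_ab).
Hypotheses (oprodT : forall x, is_oprod u n x) (phiM : {morph phi : x y / x * y}).
Hypothesis phi_gen : forall i, (i < n)%N -> phi (u i) = mgen ts n neq_ab i.

Let phi1 : phi 1 = 1.
Proof. by apply: (mulgI (phi 1)); rewrite -phiM !mulg1. Qed.

Let phi_oprod c : phi (oprod u c n) = oprod (mgen ts n neq_ab) c n.
Proof.
rewrite /oprod (big_morph phi phiM phi1); apply: eq_big_nat => i /andP[_ ltin].
by case: (c i); rewrite ?expg1 ?expg0 ?phi_gen.
Qed.

Lemma oprod_inj c c' :
  oprod u c n = oprod u c' n -> forall i, (i < n)%N -> c i = c' i.
Proof.
move=> eqc; apply: (@oprod_mgen_inj _ _ _ ts n neq_ab).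
by rewrite -!phi_oprod eqc.
Qed.

(** Every element is an ordered product, and its image is the ordered product with the same
    exponents, which the model separates. *)
Lemma model_iso_inj : injective phi.
Proof.
move=> x y; case: (oprodT x) (oprodT y) => c _ <- [c' _ <-].
rewrite !phi_oprod => /oprod_mgen_inj eqc.
exact: eq_oprod.
Qed.

Lemma model_iso_nilpotent : nilpotent_class_le G 2.
Proof.
have phiV x : phi x^-1 = (phi x)^-1.
  by apply/esym/mulg1_eq; rewrite -phiM mulgV.
have phiR x y : phi [~ x, y] = [~ phi x, phi y].
  by rewrite !commgEl !conjgE !phiM !phiV.
apply: nilpotent_class2 => x y z; apply: model_iso_inj.
by rewrite !phiR cext_comm2 phi1.
Qed.

Lemma model_iso_card : ([set: G] #= `I_(2 ^ n)%N)%card.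
Proof.
pose F := {ffun 'I_n -> bool}.
have cardF : #|F| = (2 ^ n)%N by rewrite card_ffun card_bool card_ord.
(* [oprod] takes exponents on all of [nat]; a vector of [n] bits is extended by [false]. *)
pose bits (c : F) i := if insub i is Some j then c j else false.
have bitsE (c : F) (j : 'I_n) : bits c j = c j by rewrite /bits valK.
pose g (c : F) := oprod u (bits c) n.
have g_inj : injective g.
  by move=> c c' /oprod_inj eqc; apply/ffunP => j; rewrite -!bitsE eqc.
have g_sur x : exists c, g c = x.
  have [c _ <-] := oprodT x; exists [ffun j : 'I_n => c j].
  apply: eq_oprod => i ltin.
  by rewrite -[i]/(val (Ordinal ltin)) bitsE ffunE.
pose h x := projT1 (cid (g_sur x)).
have hK : cancel h g by move=> x; apply: projT2 (cid (g_sur x)).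
have gK : cancel g h by move=> c; apply: g_inj; rewrite hK.
rewrite -cardF; apply/card_set_bijP.
exists (fun x => index (h x) (enum F)); split=> [x _|x y _ _ eqh|i ltiF] /=.
- by rewrite cardE index_mem mem_enum.
- apply: (can_inj hK); rewrite -[h x](nth_index (h x) (mem_enum F _)) eqh.
  by rewrite nth_index ?mem_enum.
- have c0 : F by exact: [ffun=> false].
  exists (g (nth c0 (enum F) i)) => //.
  by rewrite gK index_uniq ?enum_uniq // -cardE.
Qed.

End ModelIso.

(** * Normal forms in universal Coxeter groups *)

Section Universal.
Local Open Scope group_scope.
Local Open Scope classical_set_scope.
Variables (W : groupType) (S : {fset W}).
Hypotheses (coxS : coxeter_system S) (univS : universal_type S).

Definition prodw (l : seq W) : W := \prod_(s <- l) s.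

Definition reduced (l : seq W) :=
  all (mem S) l && sorted (fun x y => x != y) l.

(** Left multiplication by [s] with cancellation. As an action on words, it yields uniqueness of
    normal forms by van der Waerden's method. *)
Definition letter_act (s : W) (l : seq W) :=
  if l is t :: l' then if s == t then l' else s :: l else [:: s].

Lemma prodw_cons s l : prodw (s :: l) = s * prodw l.
Proof. by rewrite /prodw big_cons. Qed.

Lemma prodw_nil : prodw [::] = 1.
Proof. by rewrite /prodw big_nil. Qed.

Lemma prodw_cat l1 l2 : prodw (l1 ++ l2) = prodw l1 * prodw l2.
Proof. by rewrite /prodw big_cat. Qed.

Lemma involS s : s \in S -> s * s = 1.
Proof. by case: coxS => h _ /h[]. Qed.

Lemma neq1S s : s \in S -> s != 1.
Proof. by case: coxS => h _ /h[/eqP]. Qed.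

Lemma reducedP l : reduced l ->
  {subset l <= S} /\ sorted (fun x y => x != y) l.
Proof. by case/andP=> /allP. Qed.

Lemma reduced_tl s l : reduced (s :: l) -> reduced l.
Proof. by case/andP=> /= /andP[_ lS] /path_sorted sl; apply/andP. Qed.

Lemma letter_act_reduced s l :
  s \in S -> reduced l -> reduced (letter_act s l).
Proof.
move=> sS; case: l => [|t l] rl; first by rewrite /reduced /= sS.
rewrite /=; case: eqVneq => [_|neq]; first exact: reduced_tl rl.
by move: rl; rewrite /reduced /= sS neq.
Qed.

Lemma letter_actK s l : reduced l -> letter_act s (letter_act s l) = l.
Proof.
case: l => [|t l]; first by rewrite /= eqxx.
case/andP=> _ /=; case: eqVneq => [->|neq] /=; last by rewrite eqxx.
by case: l => //= t' l /andP[/negbTE -> _].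
Qed.

Lemma prodw_act s l : s \in S -> prodw (letter_act s l) = s * prodw l.
Proof.
move=> sS; case: l => [|t l]; first by rewrite /= prodw_cons.
rewrite /=; case: eqVneq => [<-|_]; last by rewrite prodw_cons.
by rewrite prodw_cons mulgA involS // mul1g.
Qed.

Lemma foldr_act_prod l : {subset l <= S} ->
  reduced (foldr letter_act [::] l) /\ prodw (foldr letter_act [::] l) = prodw l.
Proof.
elim: l => [//|s l IHl] lS /=.
have sS : s \in S by apply: lS; rewrite mem_head.
have [|rl pl] := IHl; first by move=> t tl; apply: lS; rewrite in_cons tl orbT.
by rewrite letter_act_reduced // prodw_act // pl prodw_cons.
Qed.

Lemma foldr_act_id l : reduced l -> foldr letter_act [::] l = l.
Proof.
elim: l => //= s l IHl rl; rewrite IHl ?(reduced_tl rl) //.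
by case: l rl {IHl} => //= t l /andP[_ /= /andP[/negbTE ->]].
Qed.

Lemma size_letter_act s l : size (letter_act s l) <= (size l).+1.
Proof. by case: l => //= t l; case: ifP => _ //=; apply: ltnW. Qed.

Lemma size_foldr_act l : size (foldr letter_act [::] l) <= size l.
Proof.
by elim: l => //= s l IHl; apply: leq_trans (size_letter_act _ _) _.
Qed.

(** A cancellation removes a letter where one could have been added, so equal sizes mean that none
    took place. This identifies the types of minimal galleries. *)
Lemma foldr_act_size l :
  size (foldr letter_act [::] l) = size l -> foldr letter_act [::] l = l.
Proof.
elim: l => //= s l IHl eqs.
have eql : foldr letter_act [::] l = l.
  apply: IHl; apply/eqP; rewrite eqn_leq size_foldr_act -ltnS -eqs.
  exact: size_letter_act.
move: eqs; rewrite eql; case: l {IHl eql} => //= t l.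
by case: ifP => // _ /eqP; rewrite ltn_eqF //; apply: ltnW.
Qed.

(** The sign of a letter is dropped: by [letter_actK] each letter acts on reduced words as an
    involution. *)
Let wact (u : word S) l := foldr (fun x => letter_act (val x.2)) l u.

Let wact_reduced u l : reduced l -> reduced (wact u l).
Proof.
by elim: u => //= x u IHu /IHu; apply: letter_act_reduced; apply: fsvalP.
Qed.

(* In universal type only s = t gives a relation (st)^n. *)
Let wcong_wact u v :
  wcong (@coxeter_rel W S) u v -> forall l, reduced l -> wact u l = wact v l.
Proof.
elim=> {u v}.
- move=> u v [s [t [m [ord [-> ->]]]]] l rl.
  have [eqst|neqst] := eqVneq (val s) (val t); last first.
    case: (univS (fsvalP s) (fsvalP t)); first exact/eqP.
    by exists m.
  (* For [s = t] the order is 1, so the relator is [s s], which acts trivially. *)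
  case: ord => m0 _ /(_ 1%N); rewrite -eqst expg1 involS ?fsvalP //.
  case: m m0 => [//|[|m]] _ h; last by case: h.
  by rewrite /wact /= -eqst letter_actK.
- by move=> b x l rl; rewrite /wact /= letter_actK.
- by [].
- by move=> u v _ IH l rl; rewrite IH.
- by move=> v u w _ IH1 _ IH2 l rl; rewrite IH1 ?IH2.
- move=> u u' v v' _ IH1 _ IH2 l rl.
  by rewrite /wact !foldr_cat -!/(wact _ _) IH2 // IH1 // wact_reduced.
Qed.

Let word_of l : {subset l <= S} ->
  exists u : word S, l = [seq val x.2 | x <- u].
Proof.
elim: l => [_|s l IHl lS]; first by exists [::].
have sS : s \in S by apply: lS; rewrite mem_head.
have [|u ->] := IHl; first by move=> t tl; apply: lS; rewrite in_cons tl orbT.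
by exists ((false, [` sS]%fset) :: u).
Qed.

Let wact_foldr u l : wact u l = foldr letter_act l [seq val x.2 | x <- u].
Proof. by rewrite foldr_map. Qed.

Let class_prod (f : presented (@coxeter_rel W S) -> W) :
  {morph f : x y / x * y} ->
  (forall s : S, f (pgen (@coxeter_rel W S) s) = val s) ->
  forall u, f (wclass (@coxeter_rel W S) u) = prodw [seq val x.2 | x <- u].
Proof.
move=> fM fgen u; have f1 : f 1 = 1.
  by apply: (mulgI (f 1)); rewrite -fM !mulg1.
elim: u => [|[b x] u IHu]; first by rewrite prodw_nil.
rewrite -[(b, x) :: u]cat1s wclassM fM IHu prodw_cons; congr (_ * _).
rewrite wclassE /weval big_seq1 /=; case: b => //=.
apply: (mulIg (val x)); rewrite involS ?fsvalP // -[X in _ * X]fgen -fM.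
by rewrite mulVg.
Qed.

(** Equal products come from congruent words, since the presentation map is injective; congruent
    words act alike, and a reduced word acting on the empty word returns itself. *)
Lemma reduced_inj l l' :
  reduced l -> reduced l' -> prodw l = prodw l' -> l = l'.
Proof.
move=> rl rl' eqp; case: coxS => _ [f [fM fgen fbij]].
have [lS _] := reducedP rl; have [lS' _] := reducedP rl'.
have [u eu] := word_of lS; have [u' eu'] := word_of lS'.
have /wclassP/wcong_wact/(_ [::] isT) :
    wclass (@coxeter_rel W S) u = wclass (@coxeter_rel W S) u'.
  by apply: (bij_inj fbij); rewrite !(class_prod fM fgen) -eu -eu'.
by rewrite !wact_foldr -eu -eu' !foldr_act_id.
Qed.

Lemma reduced_ex w : exists l, reduced l /\ prodw l = w.
Proof.
case: coxS => _ [f [fM fgen [g fK gK]]].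
rewrite -(gK w) -(wclass_repr (g w)) (class_prod fM fgen).
set l := map _ _; have lS : {subset l <= S}.
  by move=> _ /mapP[x _ ->]; apply: fsvalP.
by exists (foldr letter_act [::] l); apply: foldr_act_prod.
Qed.

Definition nform w := xget [::] [set l | reduced l /\ prodw l = w].

Lemma nformP w : reduced (nform w) /\ prodw (nform w) = w.
Proof.
have [l lP] := reduced_ex w; rewrite /nform.
by case: xgetP => [l' _ //|/(_ l)].
Qed.

Lemma nform_reduced w : reduced (nform w). Proof. by case: (nformP w). Qed.

Lemma nformK w : prodw (nform w) = w. Proof. by case: (nformP w). Qed.

Lemma nform_prod l : reduced l -> nform (prodw l) = l.
Proof.
by move=> rl; apply: reduced_inj; rewrite ?nform_reduced ?nformK.
Qed.

Lemma nform_mul s w : s \in S -> nform (s * w) = letter_act s (nform w).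
Proof.
move=> sS; rewrite -[in LHS](nformK w) -prodw_act // nform_prod //.
exact/letter_act_reduced/nform_reduced.
Qed.

Lemma nform1 : nform 1 = [::].
Proof. by rewrite -prodw_nil nform_prod. Qed.

Lemma nform_foldr l :
  {subset l <= S} -> nform (prodw l) = foldr letter_act [::] l.
Proof. by move=> /foldr_act_prod[rl <-]; apply: nform_prod. Qed.

(** Any word for [w] reduces to the normal form without growing. *)
Lemma cox_lengthE w : cox_length S w = size (nform w).
Proof.
have w_min : is_word_product S w (size (nform w)) /\
    forall m, is_word_product S w m -> (size (nform w) <= m)%N.
  split; first by exists (nform w); case: (reducedP (nform_reduced w));
    split; rewrite // -/(prodw _) nformK.
  by move=> _ [l [lS <- ->]]; rewrite nform_foldr // size_foldr_act.
apply: xget_unique => // m [m_prod m_min].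
by apply/eqP; rewrite eqn_leq m_min ?w_min.2 //; apply: w_min.1.
Qed.

(** * Roots are the half-trees of the Cayley graph *)

(** The half-tree containing [v] that is cut off by the edge between [v] and [v * s]. *)
Definition wroot (v s : W) : set W := lmul v (simple_root S s).

Lemma lmulE v (A : set W) x : lmul v A x <-> A (v^-1 * x).
Proof.
split=> [[y Ay <-]|Ax]; first by rewrite mulKg.
by exists (v^-1 * x); rewrite ?mulVKg.
Qed.

Lemma lmulM v u (A : set W) : lmul v (lmul u A) = lmul (v * u) A.
Proof.
by apply/seteqP; split=> x; rewrite !lmulE invgM mulgA.
Qed.

Lemma lmul1 (A : set W) : lmul 1 A = A.
Proof. by apply/seteqP; split=> x; rewrite lmulE invg1 mul1g. Qed.

Lemma lmul_wroot v u s : lmul v (wroot u s) = wroot (v * u) s.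
Proof. exact: lmulM. Qed.

Lemma wrootE v s x : s \in S -> wroot v s x <-> head 1 (nform (v^-1 * x)) != s.
Proof.
move=> sS; rewrite /wroot lmulE /simple_root /= !cox_lengthE (nform_mul _ sS).
(* For the empty word the default head 1 is not a letter. *)
case: (nform _) => [|t l] /=; first by rewrite eq_sym neq1S.
by rewrite [t == s]eq_sym; case: eqVneq => /=; split=> //; rewrite ltnNge leqnSn.
Qed.

Lemma roots_wroot v s : s \in S -> Defs.roots S (wroot v s).
Proof. by move=> sS; exists v, s. Qed.

Lemma wroot_in v s : s \in S -> wroot v s v.
Proof.
by move=> sS; apply/(wrootE _ _ sS); rewrite mulVg nform1 /= eq_sym neq1S.
Qed.

Lemma wroot_notin v s : s \in S -> ~ wroot v s (v * s).
Proof.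
move=> sS /(wrootE _ _ sS); rewrite mulKg -[s in nform s]mulg1 nform_mul //.
by rewrite nform1 /= eqxx.
Qed.

(** Right multiplication by a letter adds or removes only the last letter of the reduced word. *)
Lemma nform_rcons x s : s \in S -> x != 1 -> x * s != 1 ->
  head 1 (nform (x * s)) = head 1 (nform x).
Proof.
move=> sS; have [rl <-] := nformP x; rewrite nform_prod //.
move: (nform x) rl => l; case/lastP: l => [|l t] rl; first by rewrite prodw_nil eqxx.
move=> _; have [->|neq] := eqVneq t s.
  rewrite -cats1 prodw_cat /prodw big_seq1 -/(prodw l) -mulgA involS // mulg1.
  have rl' : reduced l.
    move: rl; rewrite /reduced all_rcons => /andP[/andP[_ ->]].
    by case: l => //= y l; rewrite rcons_path => /andP[].
  by rewrite nform_prod //; case: l {rl rl'} => //; rewrite prodw_nil eqxx.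
have rls : reduced (rcons (rcons l t) s).
  move: rl; rewrite /reduced !all_rcons /= sS => /andP[-> /=].
  case: l => [|y l] /=; first by rewrite neq.
  by rewrite [path _ _ (rcons (rcons _ _) _)]rcons_path last_rcons neq => ->.
rewrite (_ : prodw _ * s = prodw (rcons (rcons l t) s)) => [_|].
  by rewrite nform_prod //; case: l {rl rls}.
by rewrite -[in RHS]cats1 prodw_cat /prodw big_seq1.
Qed.

(** Membership depends on the first letter of the reduced word of [u^-1 * v], which a step to
    [v * s] changes only at the edge leaving [u]. So a root is left across a single edge. *)
Lemma wroot_sep u t v s : s \in S -> t \in S ->
  wroot u t v -> ~ wroot u t (v * s) -> u = v /\ t = s.
Proof.
move=> sS tS; rewrite (wrootE _ _ tS) (wrootE _ _ tS) => hv /negP.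
rewrite negbK mulgA => /eqP hvs.
have [eq1|neq1] := eqVneq (u^-1 * v) 1.
  move: hvs; rewrite eq1 mul1g -[s in nform s]mulg1 nform_mul // nform1 /=.
  by move=> ->; rewrite -(mulVKg u v) eq1 mulg1.
have [eqs|neqs] := eqVneq (u^-1 * v * s) 1.
  by move: hvs (neq1S tS); rewrite eqs nform1 /= => <-; rewrite eqxx.
by move: hv; rewrite -(nform_rcons sS neq1 neqs) hvs eqxx.
Qed.

Lemma wroot_edge alpha v s : s \in S ->
  Defs.roots S alpha -> alpha v -> ~ alpha (v * s) -> alpha = wroot v s.
Proof.
move=> sS [u [t [tS ->]]]; rewrite -/(wroot u t) => hv hvs.
by have [-> ->] := wroot_sep sS tS hv hvs.
Qed.

Lemma wroot_inj v s v' s' : s \in S -> s' \in S ->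
  wroot v s = wroot v' s' -> v = v' /\ s = s'.
Proof.
move=> sS s'S eqr; apply: wroot_sep => //; rewrite eqr.
  exact: wroot_in.
exact: wroot_notin.
Qed.

(** A reduced word from [v] that does not begin with [s] becomes, seen from [v * s], one that begins
    with [s] and hence not with [t]. *)
Lemma wroot_nested v s t : s \in S -> t \in S -> s != t ->
  wroot v s `<=` wroot (v * s) t.
Proof.
move=> sS tS neq x /(wrootE _ _ sS) hx; apply/(wrootE _ _ tS).
have -> : (v * s)^-1 * x = s * (v^-1 * x).
  by rewrite invgM mulgA; congr (_ * _ * _); apply: mulg1_eq; apply: involS.
rewrite nform_mul //; case: (nform _) hx => [|y l] //= /negbTE.
by rewrite eq_sym => ->.
Qed.

Lemma separating_wroot v s : s \in S -> separating_root S v (v * s) = wroot v s.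
Proof.
move=> sS; rewrite /separating_root.
case: xgetP => [alpha _ [ra av avs]|/(_ (wroot v s)) []].
  exact: wroot_edge.
by split; [apply: roots_wroot|apply: wroot_in|apply: wroot_notin].
Qed.

(** * Galleries *)

(** Galleries are handled through first chamber and type; [galE] shows that every gallery arises
    so. *)
Definition gal (c : W) (l : seq W) : seq W := c :: scanl *%g c l.

Fixpoint croots (c : W) (l : seq W) : seq (set W) :=
  if l is s :: l' then wroot c s :: croots (c * s) l' else [::].

Lemma gallery_type_gal c l : gallery_type (gal c l) = l.
Proof. by rewrite /= scanlK // => x; apply: mulKg. Qed.

Lemma galE G : G <> [::] -> G = gal (head 1 G) (gallery_type G).
Proof.
by case: G => // c G _; rewrite /gal /= pairmapK // => x; apply: mulVKg.
Qed.

Lemma size_gal c l : size (gal c l) = (size l).+1.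
Proof. by rewrite /= size_scanl. Qed.

Lemma last_gal x c l : last x (gal c l) = c * prodw l.
Proof.
rewrite /=; elim: l c => [|s l IHl] c /=; first by rewrite prodw_nil mulg1.
by rewrite IHl prodw_cons mulgA.
Qed.

Lemma minimal_galP c l : minimal_gallery S (gal c l) <-> reduced l.
Proof.
rewrite /minimal_gallery /is_gallery gallery_type_gal last_gal size_gal mulKg.
rewrite cox_lengthE; split=> [[[_ lS] /=]|rl].
  rewrite nform_foldr // => /foldr_act_size eql.
  by have [] := foldr_act_prod lS; rewrite eql.
by rewrite nform_prod //; split=> //; split=> //; case: (reducedP rl).
Qed.

Lemma MinP G : Min S G <-> exists2 l, reduced l & G = gal 1 l.
Proof.
split=> [[mG hG]|[l rl ->]]; last by split=> //; apply/minimal_galP.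
have [[/galE eG _] _] := mG; rewrite hG in eG.
by exists (gallery_type G) => //; apply/(minimal_galP 1); rewrite -eG.
Qed.

Lemma crossed_gal c l : {subset l <= S} -> crossed S (gal c l) = croots c l.
Proof.
rewrite /=; elim: l c => //= s l IHl c lS.
have sS : s \in S by apply: lS; rewrite mem_head.
rewrite separating_wroot // IHl // => t tl.
by apply: lS; rewrite in_cons tl orbT.
Qed.

Lemma size_croots c l : size (croots c l) = size l.
Proof. by elim: l c => //= s l IHl c; rewrite IHl. Qed.

Lemma croots_cat c l1 l2 :
  croots c (l1 ++ l2) = croots c l1 ++ croots (c * prodw l1) l2.
Proof.
elim: l1 c => [|s l1 IHl] c /=; first by rewrite prodw_nil mulg1.
by rewrite IHl prodw_cons mulgA.
Qed.

Lemma croots_take c l i : croots c (take i l) = take i (croots c l).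
Proof.
by elim: l c i => [|s l IHl] c [|i] //=; rewrite IHl.
Qed.

Lemma croots_drop c l i :
  croots (c * prodw (take i l)) (drop i l) = drop i (croots c l).
Proof.
elim: l c i => [|s l IHl] c [|i] //=; first by rewrite prodw_nil mulg1.
by rewrite prodw_cons mulgA IHl.
Qed.

Lemma croots_lmul v c l : croots (v * c) l = [seq lmul v r | r <- croots c l].
Proof. by elim: l c => //= s l IHl c; rewrite lmul_wroot -mulgA IHl. Qed.

Lemma nth_croots c l i : (i < size l)%N ->
  nth set0 (croots c l) i = wroot (c * prodw (take i l)) (nth 1 l i).
Proof.
elim: l c i => [|s l IHl] c [|i] //= ltil; first by rewrite prodw_nil mulg1.
by rewrite IHl // prodw_cons mulgA.
Qed.

Lemma reduced_cat l1 l2 : reduced (l1 ++ l2) -> reduced l1 /\ reduced l2.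
Proof.
rewrite /reduced all_cat => /andP[/andP[-> ->] /cat_sorted2[-> ->]].
by [].
Qed.

Lemma reduced_take l i : reduced l -> reduced (take i l).
Proof. by rewrite -{1}(cat_take_drop i l) => /reduced_cat[]. Qed.

Lemma reduced_drop l i : reduced l -> reduced (drop i l).
Proof. by rewrite -{1}(cat_take_drop i l) => /reduced_cat[]. Qed.

Lemma nthS l i : reduced l -> (i < size l)%N -> nth 1 l i \in S.
Proof. by move=> /reducedP[lS _] ltil; apply: lS; apply: mem_nth. Qed.

Lemma croots_uniq c l : reduced l -> uniq (croots c l).
Proof.
move=> rl; apply/(uniqP set0) => i j; rewrite !inE size_croots => lti ltj.
rewrite !nth_croots // => /wroot_inj[]; rewrite ?nthS //.
move=> /mulgI /reduced_inj eqt _.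
have := congr1 size (eqt (reduced_take i rl) (reduced_take j rl)).
by rewrite !size_takel // ltnW.
Qed.

Lemma croots_nested c l i j : reduced l -> (i <= j < size l)%N ->
  nth set0 (croots c l) i `<=` nth set0 (croots c l) j.
Proof.
move=> rl /andP[/subnK <-]; elim: (j - i) => [|m IHm] ltm //.
apply: subset_trans (IHm (ltnW ltm)) _.
rewrite !nth_croots ?(ltnW ltm) // addSn (take_nth 1) ?(ltnW ltm) //.
rewrite -cats1 prodw_cat [prodw [:: _]]/prodw big_seq1 mulgA.
apply: wroot_nested; rewrite ?nthS ?(ltnW ltm) //.
by have [_ /(sortedP 1)] := reducedP rl; apply.
Qed.

(** A root containing 1 but not the last chamber is left at some step, and is then the root crossed
    there. Conversely, crossed roots form a chain: each contains the first, which contains 1, and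
    lies in the last, which misses the end. *)
Lemma croots_inversions l alpha :
  reduced l -> inversions S (prodw l) alpha <-> alpha \in croots 1 l.
Proof.
move=> rl; split=> [[[ra a1] aw]|].
  have [lS _] := reducedP rl; rewrite -[prodw l]mul1g in aw.
  elim: l 1 lS a1 aw {rl} => [|s l IHl] c lS ac; first by rewrite prodw_nil mulg1.
  have sS : s \in S by apply: lS; rewrite mem_head.
  rewrite prodw_cons mulgA /= in_cons => aw.
  have [acs|nacs] := pselect (alpha (c * s)); last first.
    by rewrite (wroot_edge sS ra ac nacs) eqxx.
  rewrite IHl ?orbT // => t tl.
  by apply: lS; rewrite in_cons tl orbT.
move=> /(nthP set0)[i]; rewrite size_croots => ltil <-.
have lt0l : (0 < size l)%N by apply: leq_ltn_trans ltil.
split; first split.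
- by rewrite nth_croots //; apply/roots_wroot/nthS.
- apply: (@croots_nested 1 l 0 i rl ltil 1).
  by rewrite nth_croots // take0 prodw_nil mulg1; apply/wroot_in/nthS.
have leil : (i <= (size l).-1 < size l)%N by lia.
move=> /(@croots_nested 1 l _ _ rl leil).
have ltp : ((size l).-1 < size l)%N by rewrite prednK.
rewrite nth_croots //; set v := 1 * _.
have -> : prodw l = v * nth 1 l (size l).-1.
  rewrite /v mul1g -[in LHS](take_size l) -[in LHS](prednK lt0l) (take_nth 1) //.
  by rewrite -cats1 prodw_cat [prodw [:: _]]/prodw big_seq1.
exact/wroot_notin/nthS.
Qed.

Lemma nth_segment (T : Type) (x0 : T) l i j m : (i + m <= j)%N ->
  nth x0 (drop i (take j.+1 l)) m = nth x0 l (i + m).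
Proof. by move=> lej; rewrite nth_drop nth_take. Qed.

Lemma size_segment (T : Type) (l : seq T) i j : (j < size l)%N ->
  size (drop i (take j.+1 l)) = (j.+1 - i)%N.
Proof. by move=> ltjl; rewrite size_drop size_takel. Qed.

Lemma crossed_segment l i j : reduced l -> (i <= j < size l)%N ->
  crossed S (gal (prodw (take i l)) (drop i (take j.+1 l))) =
  drop i (take j.+1 (croots 1 l)).
Proof.
move=> rl /andP[leij ltjl]; rewrite crossed_gal; last first.
  by have [] := reducedP (reduced_drop i (reduced_take j.+1 rl)).
rewrite -croots_take -croots_drop mul1g take_takel //.
exact: leqW.
Qed.

(** A root determines the edge across which it is left, so the first and last crossed roots fix both
    ends of [H], and the reduced type between them is unique. Only the letters of this segment
    remain to be checked. *)
Lemma alternating_galleryP s t H l i j : reduced l -> (i <= j < size l)%N ->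
  alternating_gallery_between S s t H
    (nth set0 (croots 1 l) i) (nth set0 (croots 1 l) j) <->
  H = gal (prodw (take i l)) (drop i (take j.+1 l)) /\
  forall m, (i + m <= j)%N -> nth 1 l (i + m) = if odd m then t else s.
Proof.
move=> rl leijl; have /andP[leij ltjl] := leijl.
have ltil : (i < size l)%N by apply: leq_ltn_trans ltjl.
have rseg : reduced (drop i (take j.+1 l)) by apply/reduced_drop/reduced_take.
have szseg := size_segment i ltjl.
split=> [[mH H1 tH [hH lH]]|[-> altH]]; last first.
  split.
  - exact/minimal_galP.
  - by rewrite size_gal szseg ltnS subn_gt0.
  - rewrite gallery_type_gal size_gal szseg /=.
    apply: (@eq_from_nth _ 1) => [|m]; rewrite szseg ?size_mkseq // => ltm.
    by rewrite nth_mkseq // nth_segment ?altH //; lia.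
  - rewrite crossed_segment // -nth0 -nth_last size_segment ?size_croots //.
    by split; rewrite nth_segment ?addn0 //; [congr (nth _ _ _)|]; lia.
have [[H0 _] _] := mH; have eH := galE H0.
set c := head 1 H in eH; set l' := gallery_type H in eH.
have rl' : reduced l' by apply/(minimal_galP c); rewrite -eH.
have [l'S _] := reducedP rl'.
have cH : crossed S H = croots c l' by rewrite eH crossed_gal.
rewrite cH in hH lH; have [eqc _] : c = prodw (take i l) /\ head 1 l' = nth 1 l i.
  move: H1; rewrite eH size_gal; case: (l') l'S hH => //= y l1 l1S hH _.
  move: hH; rewrite nth_croots // mul1g => /wroot_inj.
  by apply; rewrite ?nthS // l1S // mem_head.
(* The last crossed root fixes the end chamber; letter [j] belongs to the segment since it crosses
   the root of index [j]. *)
have eqp : prodw l' = prodw (drop i (take j.+1 l)).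
  apply: (mulgI c); rewrite [in RHS]eqc.
  have -> : prodw (take i l) = prodw (take i (take j.+1 l)).
    by rewrite take_takel // leqW.
  rewrite -prodw_cat cat_take_drop (take_nth 1) // -cats1 prodw_cat.
  move: H1; rewrite eH size_gal; case/lastP: (l') l'S lH => // l1 y l1S + _.
  rewrite -cats1 croots_cat last_cat /= nth_croots // mul1g => /wroot_inj[].
  - by rewrite l1S // mem_rcons mem_head.
  - by rewrite nthS.
  by move=> <- <-; rewrite prodw_cat mulgA.
have {eqp} eql := reduced_inj rl' rseg eqp; rewrite -eql -eqc; split=> // m ltm.
have ltm' : (m < j.+1 - i)%N by lia.
move: tH; rewrite eH size_gal -eH -/l' /= => tH.
have := congr1 (fun s => nth 1 s m) tH.
by rewrite nth_mkseq ?eql ?szseg // nth_segment.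
Qed.

(** * The family along a reduced word *)

Section CalM.
Variables s0 s1 : W.
Hypotheses (s0S : s0 \in S) (s1S : s1 \in S) (neq01 : s0 != s1).

(** The four prescribed cases extend a core at [q] by at most one alternating letter on either side,
    and the prescribed roots are always those of index [q.+1] and [q.+2]. *)
Lemma calM_croots G l i j : reduced l -> (i <= j < size l)%N ->
  let ts := nth 1 l in let q := core_of s0 ts i in
  let r := nth set0 (croots 1 l) in
  calM S s0 s1 G (r i) (r j) =
  if linked s0 s1 ts i j then [set r q.+1; r q.+2] else set0.
Proof.
move=> rl leijl ts q r; have /andP[leij ltjl] := leijl.
have szc : size (drop i (take j.+1 (croots 1 l))) = (j.+1 - i)%N.
  by rewrite size_segment ?size_croots.
have neq01' := negbTE neq01; have neq10 : (s1 == s0) = false by rewrite eq_sym.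
have ltE m : (i + m <= j)%N ->
    nth set0 (drop i (take j.+1 (croots 1 l))) m = r (i + m)%N.
  exact: nth_segment.
apply/seteqP; split=> gamma.
  move=> [s [t [H [/(alternating_galleryP _ _ _ rl leijl)[-> alt]]]]].
  rewrite crossed_segment // /calM_value szc.
  have linkE p : core s0 s1 ts p -> (i == p) || (i.+1 == p) && (ts i == s1) ->
      (j == p.+3) || (j == p.+4) && (ts j == s0) ->
      [set r p.+1; r p.+2] gamma ->
      (if linked s0 s1 ts i j then [set r q.+1; r q.+2] else set0) gamma.
    move=> cp ip jp; have eqp : core_of s0 ts i = p.
      rewrite /core_of; case/orP: ip => [/eqP->|/andP[/eqP eip /eqP->]].
        by case/and4P: cp => ->.
      by rewrite neq10.
    have -> : linked s0 s1 ts i j; last by rewrite /q eqp.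
    rewrite /linked eqp cp jp andbT /=; case/orP: ip => [/eqP->|/andP[_ ->]].
      by case/and4P: cp => ->.
    exact: orbT.
  clearbody q; have tsE m k : (j.+1 - i)%N = k -> (m < k)%N ->
      ts (m + i)%N = if odd m then t else s.
    by move=> ek ltm; rewrite addnC; apply: alt; lia.
  have coreE p : (forall m, (m < 4)%N -> ts (m + p)%N = if odd m then s1 else s0) ->
      core s0 s1 ts p.
    move=> h; rewrite /core (h 0%N isT) (h 1%N isT) (h 2%N isT) (h 3%N isT).
    by rewrite !eqxx.
  (* In the first two cases the core starts at [i]; in the last two it starts at [i.+1], after an
     initial [s1]. The second and fourth have an additional final [s0]. *)
  case: ifP => [/and3P[/eqP k /eqP es /eqP et]|_].
    rewrite !ltE ?addnS ?addn0; [|lia|lia]; apply: linkE.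
    - by apply: coreE => m ltm; rewrite (tsE m 4%N) // es et.
    - by rewrite eqxx.
    - by apply/orP; left; lia.
  case: ifP => [/and3P[/eqP k /eqP es /eqP et]|_].
    rewrite !ltE ?addnS ?addn0; [|lia|lia]; apply: linkE.
    - by apply: coreE => m ltm; rewrite (tsE m 5%N) ?es ?et //; lia.
    - by rewrite eqxx.
    - have -> : j = i.+4 by lia.
      by rewrite (tsE 4%N 5%N k isT) es !eqxx orbT.
  case: ifP => [/and3P[/eqP k /eqP es /eqP et]|_].
    rewrite !ltE ?addnS ?addn0; [|lia|lia]; apply: linkE.
    - apply: coreE => m ltm; rewrite addnS -addSn (tsE m.+1 5%N) //.
      by rewrite es et /=; case: odd.
    - by rewrite (tsE 0%N 5%N k isT) es !eqxx orbT.
    - by apply/orP; left; lia.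
  case: ifP => [/and3P[/eqP k /eqP es /eqP et]|_] //.
  rewrite !ltE ?addnS ?addn0; [|lia|lia]; apply: linkE.
  - apply: coreE => m ltm; rewrite addnS -addSn (tsE m.+1 6%N) //; last lia.
    by rewrite es et /=; case: odd.
  - by rewrite (tsE 0%N 6%N k isT) es !eqxx orbT.
  - have -> : j = i.+1.+4 by lia.
    by rewrite (tsE 5%N 6%N k isT) et !eqxx orbT.
case: ifP => // /and3P[cq iq jq].
suff [s [t [alt <-]]] : exists s t,
    (forall m, (i + m <= j)%N -> ts (i + m)%N = if odd m then t else s) /\
    calM_value s0 s1 s t (drop i (take j.+1 (croots 1 l))) =
      [set r q.+1; r q.+2].
  exists s, t, (gal (prodw (take i l)) (drop i (take j.+1 l))).
  rewrite crossed_segment //; split=> //.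
  by apply/(alternating_galleryP _ _ _ rl leijl).
rewrite -/q in cq jq.
have iE : i = q \/ i.+1 = q /\ ts i = s1.
  case/orP: iq => /eqP ti; [left|right].
    by rewrite /q /core_of ti eqxx.
  by rewrite /q /core_of ti neq10.
clearbody q; case/and4P: cq => /eqP q0 /eqP q1 /eqP q2 /eqP q3.
case: iE => [iE|[iE ti]].
- case/orP: jq => [/eqP ej|/andP[/eqP ej /eqP tj]].
  + exists s0, s1; split.
      move=> m lem; have : (m < 4)%N by lia.
      rewrite iE; case: m {lem} => [|[|[|[|m]]]] //= _;
        rewrite ?addnS ?addn0 //.
    rewrite /calM_value szc (_ : (j.+1 - i)%N = 4%N) ?eqxx /=; last by lia.
    by rewrite !ltE -?iE ?addnS ?addn0 //; lia.
  + exists s0, s1; split.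
      move=> m lem; have : (m < 5)%N by lia.
      rewrite iE; case: m {lem} => [|[|[|[|[|m]]]]] //= _;
        rewrite ?addnS ?addn0 //.
      by rewrite -ej.
    rewrite /calM_value szc (_ : (j.+1 - i)%N = 5%N) ?eqxx /=; last by lia.
    by rewrite !ltE -?iE ?addnS ?addn0 //; lia.
- case/orP: jq => [/eqP ej|/andP[/eqP ej /eqP tj]].
  + exists s1, s0; split.
      move=> m lem; have : (m < 5)%N by lia.
      rewrite -iE in q0 q1 q2 q3; case: m {lem} => [|[|[|[|[|m]]]]] //= _;
        rewrite ?addnS ?addn0 //.
    rewrite /calM_value szc (_ : (j.+1 - i)%N = 5%N) ?neq10 ?neq01' ?eqxx /=.
      by rewrite !ltE -?iE ?addnS ?addn0 //; lia.
    by lia.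
  + exists s1, s0; split.
      move=> m lem; have : (m < 6)%N by lia.
      rewrite -?iE in q0 q1 q2 q3 ej; case: m {lem} => [|[|[|[|[|[|m]]]]]] //= _;
        rewrite ?addnS ?addn0 //.
      by rewrite -ej.
    rewrite /calM_value szc (_ : (j.+1 - i)%N = 6%N) ?neq10 ?neq01' ?eqxx /=.
      by rewrite !ltE -?iE ?addnS ?addn0 //; lia.
    by lia.
Qed.
Lemma calM_value_lmul v s t c gamma : calM_value s0 s1 s t c gamma ->
  calM_value s0 s1 s t [seq lmul v r | r <- c] (lmul v gamma).
Proof.
have nthE i : (i < size c)%N ->
    nth set0 [seq lmul v r | r <- c] i = lmul v (nth set0 c i).
  by move=> lti; rewrite (nth_map set0).
rewrite /calM_value size_map.
case: ifP => [/and3P[/eqP k _ _]|_].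
  by case=> ->; [left|right]; rewrite nthE ?k.
case: ifP => [/and3P[/eqP k _ _]|_].
  by case=> ->; [left|right]; rewrite nthE ?k.
case: ifP => [/and3P[/eqP k _ _]|_].
  by case=> ->; [left|right]; rewrite nthE ?k.
case: ifP => [/and3P[/eqP k _ _]|_] //.
by case=> ->; [left|right]; rewrite nthE ?k.
Qed.

Lemma calM_lmul_in v G G' alpha beta gamma : calM S s0 s1 G alpha beta gamma ->
  calM S s0 s1 G' (lmul v alpha) (lmul v beta) (lmul v gamma).
Proof.
move=> [s [t [H [[mH H1 tH [hH lH]] gammaP]]]].
have [[/galE eH _] _] := mH; move: (head _ _) (gallery_type H) eH tH => c l.
move=> eH tH; rewrite eH in tH.
have rl : reduced l by apply/(minimal_galP c); rewrite -eH.
have [lS _] := reducedP rl; rewrite eH in H1 mH.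
rewrite eH crossed_gal // in hH lH gammaP.
have l0 : croots c l != [::].
  by move: H1; rewrite -size_eq0 size_croots size_gal; case: (l).
exists s, t, (gal (v * c) l); rewrite crossed_gal // croots_lmul.
split; last exact: calM_value_lmul.
split; rewrite ?crossed_gal ?croots_lmul ?gallery_type_gal -?hH -?lH //.
- exact/minimal_galP.
- by move: H1; rewrite !size_gal.
- by move: tH; rewrite !size_gal.
- by case: (croots c l) l0 => //= r rs _; rewrite (last_map (lmul v)).
Qed.

(** Left translation preserves the type of a gallery and translates the crossed roots; translating
    back by [v^-1] gives the other inclusion. Weyl-invariance is a special case. *)
Lemma calM_lmul v G G' alpha beta :
  calM S s0 s1 G' (lmul v alpha) (lmul v beta) =
  [set lmul v gamma | gamma in calM S s0 s1 G alpha beta].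
Proof.
apply/seteqP; split=> gamma; last first.
  by move=> [delta Md <-]; apply: calM_lmul_in Md.
move=> /(@calM_lmul_in v^-1 _ G); rewrite !lmulM mulVg !lmul1 => Mgamma.
by exists (lmul v^-1 gamma) => //; rewrite lmulM mulgV lmul1.
Qed.

(** In a chain the intersection of two roots is the smaller one and their complements meet in the
    complement of the larger one. *)
Lemma croots_open_interval l i m j : reduced l -> (i < m < j)%N ->
  (j < size l)%N ->
  let r := nth set0 (croots 1 l) in open_interval S (r i) (r j) (r m).
Proof.
move=> rl /andP[ltim ltmj] ltjl r.
have neq p q : (p < size l)%N -> (q < size l)%N -> p != q -> r p <> r q.
  move=> ltp ltq /eqP neq eqr; apply: neq; apply/eqP.
  by rewrite -(nth_uniq set0 _ _ (croots_uniq 1 rl)) ?size_croots // -/r eqr.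
split; first split.
- by rewrite /r nth_croots; [apply/roots_wroot/nthS => //|]; lia.
- by move=> x [+ _]; apply: croots_nested => //; lia.
- by move=> x [_ +] rx; apply; move: x rx; apply: croots_nested => //; lia.
by case; apply: neq; lia.
Qed.

Lemma index_tripleP G alpha beta : index_triple S G alpha beta ->
  exists l i j, [/\ reduced l, G = gal 1 l, (i <= j < size l)%N,
    alpha = nth set0 (croots 1 l) i & beta = nth set0 (croots 1 l) j].
Proof.
case=> /MinP[l rl ->] _ _ []; rewrite crossed_gal; last by case: (reducedP rl).
move=> al be leab; exists l, (index alpha (croots 1 l)), (index beta (croots 1 l)).
split=> //; rewrite ?nth_index // leab /=.
by rewrite -(size_croots 1) index_mem.
Qed.

(** Both factors of the commutator lie strictly between [i] and [j]: this gives the interval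
    condition and the triangular form needed to collect products. *)
Lemma linked_bounds ts i j : linked s0 s1 ts i j ->
  let q := core_of s0 ts i in (i < q.+1)%N && (q.+2 < j)%N.
Proof.
case/and3P=> _ _ hj; have leiq : (i <= core_of s0 ts i)%N.
  by rewrite /core_of; case: ifP.
by move: (core_of _ _ _) hj leiq => q hj leiq /=; lia.
Qed.

Lemma calM_sub G alpha beta : index_triple S G alpha beta ->
  calM S s0 s1 G alpha beta `<=` open_interval S alpha beta.
Proof.
move=> /index_tripleP[l [i [j [rl _ leij -> ->]]]].
rewrite calM_croots //; case: ifP => // /linked_bounds /=.
move: (core_of _ _ _) => q ltq gamma.
by case=> ->; apply: croots_open_interval; lia.
Qed.

(** * The groups U_w *)

Section GroupU.
Variable w : W.
Let l := nform w.
Let n := size l.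
Let r := nth set0 (croots 1 l).
Let ts := nth 1 l.
Let M := calM S s0 s1.
Let X : choiceType := inversions S w.
Let rl : reduced l := nform_reduced w.
Let lS : {subset l <= S} := (reducedP rl).1.

Let gal_to G : Min_to S w G <-> G = gal 1 l.
Proof.
split=> [[/MinP[l' rl' ->]]|->].
  by rewrite last_gal mul1g /l => <-; rewrite nform_prod.
by split; [apply/MinP; exists l|rewrite last_gal mul1g nformK].
Qed.

Let rP alpha : inversions S w alpha <-> alpha \in croots 1 l.
Proof. by rewrite -[w]nformK; apply: croots_inversions. Qed.

Let r_in i : (i < n)%N -> r i \in croots 1 l.
Proof. by move=> ltin; rewrite mem_nth ?size_croots. Qed.

Let index_r i : (i < n)%N -> index (r i) (croots 1 l) = i.
Proof. by move=> ltin; rewrite index_uniq ?size_croots ?croots_uniq. Qed.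

(** Extended by 1 to all sets of chambers, so that products may range over roots without membership
    proofs. *)
Definition ugen (g : set W) : U S M w :=
  if insub g is Some a then pgen (@U_rel W S M w) (a : X) else 1.

Let ugenE (a : X) : ugen (val a) = pgen (@U_rel W S M w) a.
Proof. by rewrite /ugen valK. Qed.

(** Every crossed root is an inversion of [w], so [insub] drops no factor. *)
Let wevalE (E : groupType) (phi : X -> E) (psi : set W -> E) G A :
  (forall a : X, psi (val a) = phi a) -> G = gal 1 l ->
  weval phi (gallery_prod S w G A) =
  \prod_(g <- [seq gamma <- croots 1 l | gamma \in A]) psi g.
Proof.
move=> psiE ->; rewrite /gallery_prod crossed_gal //.
have : {subset [seq gamma <- croots 1 l | gamma \in A] <= croots 1 l}.
  exact: mem_subseq (filter_subseq _ _).
elim: [seq _ <- _ | _] => [|g s IHs] sub /=; first by rewrite big_nil /weval big_nil.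
rewrite big_cons -IHs => [|x xs]; last by apply: sub; rewrite in_cons xs orbT.
have /rP/mem_set gX := sub _ (mem_head _ _).
rewrite insubT /= -[_ :: flatten _]cat1s weval_cat; congr (_ * _).
by rewrite [LHS]weval_gen -psiE SubK.
Qed.

Let calM_filter (E : groupType) (psi : set W -> E) G i j :
  (i <= j < n)%N ->
  let q := core_of s0 ts i in
  \prod_(g <- [seq gamma <- croots 1 l | gamma \in M G (r i) (r j)]) psi g =
  if linked s0 s1 ts i j then psi (r q.+1) * psi (r q.+2) else 1.
Proof.
move=> leij q; rewrite /M calM_croots // -/ts -/q -/r; case: ifP => [|_]; last first.
  rewrite (eq_filter (a2 := pred0)) ?filter_pred0 ?big_nil // => g.
  by rewrite in_set0.
move=> /linked_bounds; rewrite -/q => ltq; have ltqn : (q.+2 < n)%N by lia.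
have -> : [seq gamma <- croots 1 l | gamma \in [set r q.+1; r q.+2]] =
    [:: r q.+1; r q.+2]; last by rewrite big_cons big_seq1.
have -> : [:: r q.+1; r q.+2] = [seq r m | m <- [:: q.+1; q.+2]] by [].
rewrite -[croots 1 l in LHS](mkseq_nth set0) /mkseq -/r filter_map; congr map.
(* Both index lists are strictly increasing, so it suffices to compare their members. *)
apply: (irr_sorted_eq ltn_trans ltnn); rewrite ?sorted_filter ?iota_ltn_sorted //=.
- exact: ltn_trans.
- by rewrite ltnSn.
move=> m; rewrite mem_filter mem_iota size_croots -/n add0n !inE /=.
apply/andP/orP => [[/set_mem Mm ltmn]|mq]; last first.
  by split; [apply/mem_set; case: mq => /eqP->; [left|right]|lia].
have {}Mm : r m = r q.+1 \/ r m = r q.+2 by [].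
have rI p : (p < n)%N -> r m = r p -> m == p.
  by move=> ltp /eqP; rewrite nth_uniq ?size_croots ?croots_uniq.
by case: Mm => /rI ->; [left|lia|right|].
Qed.

Let triple_r G i j : (i <= j < n)%N -> G = gal 1 l ->
  index_triple S G (r i) (r j).
Proof.
move=> /andP[leij ltjn] ->; have ltin := leq_ltn_trans leij ltjn.
split; first by apply/MinP; exists l.
- by have /rP[] := r_in ltin.
- by have /rP[] := r_in ltjn.
by split; rewrite crossed_gal ?r_in // !index_r.
Qed.

Let u i : U S M w := ugen (r i).

Let u_gen i : (i < n)%N -> {a : X | val a = r i & u i = pgen (@U_rel W S M w) a}.
Proof.
move=> /r_in/rP/mem_set rX; pose a : X := Sub (r i) rX.
have aE : val a = r i by apply: SubK.
by exists a => //; rewrite /u -aE ugenE.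
Qed.

Let pgen2 (a : X) : pgen (@U_rel W S M w) a * pgen (@U_rel W S M w) a = 1.
Proof.
by rewrite -wclassM; apply/wclassP/wcong_rel; left; exists a.
Qed.

Let u2 i : (i < n)%N -> u i * u i = 1.
Proof. by move=> /u_gen[a _ ->]. Qed.

Let u_comm i j : (i < j < n)%N -> [~ u i, u j] =
  if linked s0 s1 ts i j
  then u (core_of s0 ts i).+1 * u (core_of s0 ts i).+2 else 1.
Proof.
move=> /andP[ltij ltjn]; have ltin := ltn_trans ltij ltjn.
have leij : (i <= j < n)%N by rewrite ltnW.
rewrite -(calM_filter ugen (gal 1 l) leij) -(wevalE _ ugenE (erefl _)) -wclassE.
have [a aE ->] := u_gen ltin; have [b bE ->] := u_gen ltjn.
rewrite -(weval_gen (pgen (@U_rel W S M w)) a).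
rewrite -(weval_gen (pgen (@U_rel W S M w)) b) -weval_wcomm -wclassE.
apply/wclassP/wcong_rel; right; exists (gal 1 l), a, b; split=> //.
- exact/gal_to.
- by rewrite aE bE; apply: triple_r.
- by rewrite aE bE.
Qed.

(** By [u_comm] a commutator with [u k] involves only earlier generators, so ordered products are
    closed under multiplication; inverse letters are generators again. *)
Let oprodT x : is_oprod u n x.
Proof.
have uM y z : is_oprod u n y -> is_oprod u n z -> is_oprod u n (y * z).
  apply: (@is_oprodM _ u n) => // i k ltik ltkn; rewrite u_comm ?ltik //.
  case: ifP => [|_]; last exact: is_oprod1.
  move=> /linked_bounds /= ltq.
  apply: (@is_oprod_le _ _ (core_of s0 ts i).+3); first by lia.
  by apply: (is_oprodS true); apply: is_oprod_gen.
rewrite -(wclass_repr x) wclassE /weval; elim/big_rec: _ => [|[b a] y _].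
  exact: is_oprod1.
apply: uM => /=.
have aV : (pgen (@U_rel W S M w) a)^-1 = pgen (@U_rel W S M w) a.
  exact/mulg1_eq/pgen2.
have -> : (if b then (pgen (@U_rel W S M w) a)^-1 else pgen (@U_rel W S M w) a) =
    u (index (val a) (croots 1 l)).
  rewrite aV if_same /u -ugenE /r nth_index //.
  by apply/rP/set_mem; apply: valP.
apply: is_oprod_gen; rewrite /n -(size_croots 1) index_mem.
by apply/rP/set_mem; apply: valP.
Qed.

Let phi0 (g : set W) : model ts n neq01 := mgen ts n neq01 (index g (croots 1 l)).

Let phi0_r i : (i < n)%N -> phi0 (r i) = mgen ts n neq01 i.
Proof. by move=> ltin; rewrite /phi0 index_r. Qed.

Let phiR v v' : @U_rel W S M w v v' ->
  weval (phi0 \o val) v = weval (phi0 \o (val : X -> _)) v'.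
Proof.
case=> [[a [-> ->]]|[G [a [b [/gal_to eG tG -> ->]]]]].
  by rewrite weval_cat !weval_gen /= mgen2 /weval big_nil.
have [l' [i [j [rl' eG' leij aE bE]]]] := index_tripleP tG.
have eql : l' = l.
  by rewrite -(gallery_type_gal 1 l') -eG' eG gallery_type_gal.
rewrite eql in leij aE bE.
rewrite weval_wcomm !weval_gen /= (wevalE (psi := phi0)) // aE bE calM_filter //.
have /andP[leij' ltjn] := leij.
have ltin := leq_ltn_trans leij' ltjn; rewrite (phi0_r ltin) (phi0_r ltjn).
have [eqij|ltij] := eqVneq i j; last first.
  have ltijn : (i < j < n)%N by rewrite ltn_neqAle ltij leij' ltjn.
  rewrite mgen_comm //; case: ifP => // /linked_bounds /= ltq.
  by rewrite !phi0_r //; rewrite /n; lia.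
(* Index triples allow [alpha = beta]; both sides are then trivial, as no index is linked to
   itself. *)
rewrite eqij commgg; case: ifP => // /linked_bounds /=.
have : (j <= core_of s0 ts j)%N by rewrite /core_of; case: ifP.
by lia.
Qed.

Let phi : U S M w -> model ts n neq01 := plift (phi0 \o (val : X -> _)).

Let phiM : {morph phi : x y / x * y}.
Proof. exact: pliftM. Qed.

Let phi_gen i : (i < n)%N -> phi (u i) = mgen ts n neq01 i.
Proof.
move=> ltin; have [a aE ->] := u_gen ltin.
by rewrite /phi plift_class // weval_gen /= aE phi0_r.
Qed.

Lemma U_card : ([set: U S M w] #= `I_((2 ^ cox_length S w)%N))%card.
Proof. by rewrite cox_lengthE; apply: model_iso_card oprodT phiM phi_gen. Qed.

Lemma U_nilpotent : nilpotent_class_le (U S M w) 2.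
Proof. exact: model_iso_nilpotent oprodT phiM phi_gen. Qed.

End GroupU.
End CalM.
End Universal.

Theorem theorem4p8 (W : groupType) (S : {fset W}) (s0 s1 : W) :
  coxeter_system S -> universal_type S -> 2 <= #|` S| ->
  s0 \in S -> s1 \in S -> s0 <> s1 ->
  [/\ commutator_blueprint S (calM S s0 s1),
      weyl_invariant S (calM S s0 s1) &
      forall w : W, nilpotent_class_le (U S (calM S s0 s1) w) 2].
Proof.
move=> coxS univS _ s0S s1S /eqP neq01; split.
- split=> [G alpha beta|||w].
  + exact: calM_sub.
  (* (CB1): the value of [calM] is a function of the two roots alone. *)
  + by [].
  (* (CB2) is vacuous: in universal type no product of two distinct generators has finite order. *)
  + by move=> s t sS tS neq /(univS _ _ sS tS neq).
  + exact: U_card.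
- by move=> w s G sS _ alpha beta _ _ _; apply: calM_lmul.
- by move=> w; apply: U_nilpotent.
Qed.
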